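(* Let $\mathbf X=(\Omega,\mathscr F,\mathscr F_{r,t},\mathbf X(t),\mathbf P_{r,\mathbf x})$ be a TCBVE-process started from time $r\ge 0$ (so $\mathbf P_{r,\mathbf x}\{\mathbf X(r)=\mathbf x\}=1$). For $i=1,2$, let $\zeta_i$ be a $\sigma$-finite measure on $\mathbb R_+$ with $\zeta_i(B)<\infty$ for every bounded Borel set $B\subset\mathbb R_+$. Then for all $t\ge r$ and $\mathbf x\in\mathbb R_+^2$, \[ \mathbf P_{r,\mathbf x}\exp\Big\{-\sum_{i=1}^2\int_{[r,t]}X_i(s)\,\zeta_i(\mathrm ds)\Big\}=\exp\{-\langle\mathbf x,\mathbf w_{r,t}\rangle\}, \] where $r\mapsto\mathbf w_{r,t}=(w_{1,r,t},w_{2,r,t})$ is the unique positive solution on $[0,t]$ of \[ w_{i,r,t}=\int_{[r,t]}\zeta_i(\mathrm ds)-\int_r^t w_{i,s,t}\,b_{ii}(\mathrm ds)+\int_r^t w_{j,s,t}\,b_{ij}(\mathrm ds)-\int_r^t w_{i,s,t}^2\,c_i(\mathrm ds)-\int_r^t\int_{\mathbb R_+^2\setminus\{\mathbf 0\}}K_i(\mathbf w_{s,t},\mathbf z)\,m_i(\mathrm ds,\mathrm d\mathbf z), \] for $r\in[0,t]$, $i,j=1,2$, $j\neq i$.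
   Context: Conventions: $\mathbb R_+=[0,\infty)$; $\langle\cdot,\cdot\rangle$, $\|\cdot\|$ Euclidean inner product and norm on $\mathbb R^2$; for $t\ge r$, $\int_r^t$ means $\int_{(r,t]}$; $\mathbf P_{r,\mathbf x}F$ denotes the expectation of $F$ under $\mathbf P_{r,\mathbf x}$. Parameters: for $i=1,2$ and $j\ne i$: $c_i$ is increasing continuous on $[0,\infty)$ with $c_i(0)=0$; $b_{ii}$ is càdlàg on $[0,\infty)$ with $b_{ii}(0)=0$ and locally bounded variation; $m_i$ is a $\sigma$-finite measure on $(0,\infty)\times(\mathbb R_+^2\setminus\{\mathbf 0\})$ with $\int_0^t\int(z_i^2\mathbf 1_{\{\|\mathbf z\|\le1\}}+z_i\mathbf 1_{\{\|\mathbf z\|>1\}}+z_j)\,m_i(\mathrm ds,\mathrm d\mathbf z)<\infty$ for all $t\ge0$ and $b_{ii}(t)-b_{ii}(t-)+\int z_i\,m_i(\{t\},\mathrm d\mathbf z)\le1$ for all $t$; $b_{ij}$ is increasing càdlàg on $[0,\infty)$ with $b_{ij}(0)=0$. $K_i(\boldsymbol\lambda,\mathbf z)=e^{-\langle\boldsymbol\lambda,\mathbf z\rangle}-1+\lambda_iz_i$. It is known that for each $\boldsymbol\lambda\in\mathbb R_+^2$, $t\ge0$ there is a unique bounded solution $r\mapsto\mathbf v_{r,t}(\boldsymbol\lambda)$ on $[0,t]$ of $v_{i,r,t}(\boldsymbol\lambda)=\lambda_i+\int_r^t v_{j,s,t}(\boldsymbol\lambda)b_{ij}(\mathrm ds)-\int_r^t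 v_{i,s,t}(\boldsymbol\lambda)b_{ii}(\mathrm ds)-\int_r^t v_{i,s,t}(\boldsymbol\lambda)^2c_i(\mathrm ds)-\int_r^t\int K_i(\mathbf v_{s,t}(\boldsymbol\lambda),\mathbf z)m_i(\mathrm ds,\mathrm d\mathbf z)$, and a transition semigroup $(Q_{r,t})_{t\ge r\ge0}$ on $\mathbb R_+^2$ with $\int e^{-\langle\boldsymbol\lambda,\mathbf y\rangle}Q_{r,t}(\mathbf x,\mathrm d\mathbf y)=e^{-\langle\mathbf x,\mathbf v_{r,t}(\boldsymbol\lambda)\rangle}$. A TCBVE-process is a (càdlàg) Markov process in $\mathbb R_+^2$ with transition semigroup $(Q_{r,t})$. *)

(* Defs.v *)
From HB Require Import structures.
From mathcomp Require Import all_boot all_order all_algebra.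
From mathcomp Require Import all_classical all_reals all_analysis.
From mathcomp Require Import measurable_realfun.
Set Implicit Arguments. Unset Strict Implicit. Unset Printing Implicit Defensive.
Import Order.TTheory GRing.Theory Num.Theory.
Import numFieldNormedType.Exports.
Local Open Scope classical_set_scope.
Local Open Scope ring_scope.

Section TCBVE.
Variable R : realType.

Definition crd (x : R * R) (i : 'I_2) : R := if i == ord0 then x.1 else x.2.
Definition oth (i : 'I_2) : 'I_2 := if i == ord0 then ord_max else ord0.
Definition dotp (x y : R * R) : R := x.1 * y.1 + x.2 * y.2.
Definition enorm (z : R * R) : R := Num.sqrt (z.1 ^+ 2 + z.2 ^+ 2).
Definition Rp2 : set (R * R) := [set x | 0 <= x.1 /\ 0 <= x.2].
Definition Rp2_0 : set (R * R) := Rp2 `\ (0, 0).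

Definition Ioc (a b : R) : set R := `]a, b]%classic.
Definition Icc (a b : R) : set R := `[a, b]%classic.
Definition Ioo_inf (a : R) : set R := `]a, +oo[%classic.
Definition Ici (a : R) : set R := `[a, +oo[%classic.

Definition Kfun (i : 'I_2) (l z : R * R) : R :=
  expR (- dotp l z) - 1 + crd l i * crd z i.

Definition mom (i : 'I_2) (z : R * R) : R :=
  (if enorm z <= 1 then crd z i ^+ 2 else crd z i) + crd z (oth i).

Definition stieltjes_of (f : R -> R) (mu : set R -> \bar R) : Prop :=
  forall a c, 0 <= a -> a <= c -> mu (Ioc a c) = (f c - f a)%:E.

(** (mp, mn) is the Jordan decomposition on (0, oo) of the signed measure
    b(ds) of a cadlag function b of locally bounded variation:
    both locally finite, mutually singular, and
    b c - b a = mp (a, c] - mn (a, c] for 0 <= a <= c.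
    Then  int f(s) b(ds) := int f dmp - int f dmn. *)
Definition jordan_stieltjes (b : R -> R) (mp mn : set R -> \bar R) : Prop :=
  [/\ forall a c, 0 <= a -> a <= c -> (mp (Ioc a c) < +oo)%E,
      forall a c, 0 <= a -> a <= c -> (mn (Ioc a c) < +oo)%E,
      forall a c, 0 <= a -> a <= c ->
        (b c - b a)%:E = (mp (Ioc a c) - mn (Ioc a c))%E &
      exists A : set R, [/\ measurable A, A `<=` Ioo_inf 0,
        mp (Ioo_inf 0 `\` A) = 0%E & mn A = 0%E]].

(** The parameters (c_i, b_ii, b_ij, m_i), i = 1,2, j <> i, together with
    the (Lebesgue-)Stieltjes measures c_i(ds), b_ii(ds) (Jordan parts),
    b_ij(ds) used to integrate against them. *)
Record tcbve_params := TcbveParams {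
  c_  : 'I_2 -> R -> R;
  mc  : 'I_2 -> {measure set R -> \bar R};
  bd  : 'I_2 -> R -> R;
  mbp : 'I_2 -> {measure set R -> \bar R};
  mbn : 'I_2 -> {measure set R -> \bar R};
  bo  : 'I_2 -> R -> R;                      (* b_ij, j = oth i *)
  mbo : 'I_2 -> {measure set R -> \bar R};
  mm  : 'I_2 -> {measure set (R * (R * R)) -> \bar R}
}.

Definition params_ok (p : tcbve_params) : Prop :=
  forall i : 'I_2,
  [/\
      [/\ c_ p i 0 = 0,
          {in `[0, +oo[ &, {homo c_ p i : x y / x <= y}},
          {within `[0, +oo[%classic, continuous (c_ p i)} &
          stieltjes_of (c_ p i) (mc p i)],
      [/\ bd p i 0 = 0,
          forall t, 0 <= t -> bd p i s @[s --> t^'+] --> bd p i t,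
          forall t, 0 < t -> cvg (bd p i s @[s --> t^'-]) &
          jordan_stieltjes (bd p i) (mbp p i) (mbn p i)],
      [/\ bo p i 0 = 0,
          {in `[0, +oo[ &, {homo bo p i : x y / x <= y}},
          forall t, 0 <= t -> bo p i s @[s --> t^'+] --> bo p i t &
          stieltjes_of (bo p i) (mbo p i)] &
      [/\ sigma_finite setT (mm p i),
          mm p i (~` (Ioo_inf 0 `*` Rp2_0)) = 0%E,
          forall t, 0 <= t ->
            (\int[mm p i]_(q in Ioc 0 t `*` Rp2_0) (mom i q.2)%:E < +oo)%E &
          forall t, 0 < t ->
            ((bd p i t - lim (bd p i s @[s --> t^'-]))%:E
             + \int[mm p i]_(q in [set t] `*` Rp2_0) (crd q.2 i)%:E <= 1)%E]].

Definition tcbve_eq (p : tcbve_params) (t : R) (a : 'I_2 -> R -> \bar R)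
    (w : R -> R * R) : Prop :=
  forall r, 0 <= r <= t -> forall i : 'I_2,
  let wi := fun s => crd (w s) i in
  let wj := fun s => crd (w s) (oth i) in
  [/\ (mbp p i).-integrable (Ioc r t) (fun s => (wi s)%:E),
      (mbn p i).-integrable (Ioc r t) (fun s => (wi s)%:E),
      (mbo p i).-integrable (Ioc r t) (fun s => (wj s)%:E),
      (mc p i).-integrable (Ioc r t) (fun s => (wi s ^+ 2)%:E) &
      (mm p i).-integrable (Ioc r t `*` Rp2_0)
          (fun q => (Kfun i (w q.1) q.2)%:E)] /\
      ((wi r)%:E =
         a i r
         - (\int[mbp p i]_(s in Ioc r t) (wi s)%:E
            - \int[mbn p i]_(s in Ioc r t) (wi s)%:E)
         + \int[mbo p i]_(s in Ioc r t) (wj s)%:E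
         - \int[mc p i]_(s in Ioc r t) (wi s ^+ 2)%:E
         - \int[mm p i]_(q in Ioc r t `*` Rp2_0) (Kfun i (w q.1) q.2)%:E)%E.

Definition v_ok (p : tcbve_params) (v : R -> R -> R * R -> R * R) : Prop :=
  forall t (l : R * R), 0 <= t -> Rp2 l ->
    (exists M : R, forall r i, 0 <= r <= t -> `|crd (v r t l) i| <= M) /\
    tcbve_eq p t (fun i _ => (crd l i)%:E) (fun r => v r t l).

Definition Q_ok (v : R -> R -> R * R -> R * R)
    (Q : R -> R -> R * R -> {measure set (R * R) -> \bar R}) : Prop :=
  forall r t, 0 <= r <= t ->
  [/\ forall x, Rp2 x -> Q r t x setT = 1%E,
      forall x, Rp2 x -> Q r t x (~` Rp2) = 0%E,
      forall B, measurable B -> measurable_fun Rp2 ((fun x => Q r t x B) : R * R -> \bar R) &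
      forall x l, Rp2 x -> Rp2 l ->
        (\int[Q r t x]_y (expR (- dotp l y))%:E = (expR (- dotp x (v r t l)))%:E)%E].

Definition is_TCBVE (Q : R -> R -> R * R -> {measure set (R * R) -> \bar R})
    (d : measure_display) (Omega : measurableType d)
    (F : R -> R -> set (set Omega)) (X : R -> Omega -> R * R)
    (P : R -> R * R -> probability Omega R) : Prop :=
  [/\
      forall r t, 0 <= r <= t ->
        sigma_algebra setT (F r t) /\ F r t `<=` measurable,
      forall r s t, 0 <= r -> r <= s -> s <= t ->
        F r s `<=` F r t /\
        (forall B, measurable B -> F r t (X s @^-1` B)),
      forall om : Omega,
        [/\ forall t, 0 <= t -> Rp2 (X t om),
             forall t, 0 <= t -> X s om @[s --> t^'+] --> X t om &
             forall t, 0 < t -> exists l : R * R, X s om @[s --> t^'-] --> l],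
      forall r x, 0 <= r -> Rp2 x -> P r x [set om | X r om = x] = 1%E &
      forall r s t x, 0 <= r -> r <= s -> s <= t -> Rp2 x ->
        forall A B, F r s A -> measurable B ->
          P r x (A `&` X t @^-1` B) = (\int[P r x]_(om in A) Q s t (X s om) B)%E].

End TCBVE.

(* Main.v *)
Require Import Defs.
From HB Require Import structures.
From mathcomp Require Import all_boot all_order all_algebra.
From mathcomp Require Import all_classical all_reals all_analysis.
From mathcomp Require Import measurable_realfun finmap ring lra.
Import Order.TTheory GRing.Theory Num.Theory.
Import numFieldNormedType.Exports.
Import HBNNSimple.
Local Open Scope classical_set_scope.
Local Open Scope ring_scope.

(* The occupation measures are replaced by measures carried by a grid of mesh
   1/(n+1), each cell (s', s] being lumped at its right end s. For the discrete
   measures, iterating the Markov property backwards from t turns the Laplace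
   functional into exp(-<x, w_n(r)>), where w_n is obtained by gluing solutions
   v of the cumulant equation and hence solves the integral equation with the
   discretized forcing term. Right-continuity of the paths and dominated
   convergence make the Laplace functionals converge to a positive limit, which
   yields the pointwise limit w of w_n. Since K_i(w, z) >= - w_j z_j, a Gronwall
   argument bounds the w_n uniformly in n, so the limit can be taken inside the
   integral equation. The same Gronwall lemma gives uniqueness, nonnegative
   solutions being automatically bounded by the integrability requirement. *)

(** Probability replaces compactness: the Laplace functionals started from the two unit vectors
    determine the coordinates of [w_n], so their convergence gives [w_n(r) -> w(r)] at each [r]
    separately. Existence is thus read off the process instead of being constructed from the
    equation. Nonnegativity enters before any Lipschitz estimate. In the positive quadrant the
    quadratic and kernel terms are bounded above by linear ones, although not below, and this
    one-sided bound yields a common bound [M] for all the [w_n]. On a bounded square every term is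
    Lipschitz, which serves for the limit under the integrals as well as for uniqueness. No sign is
    assumed for [v]; it comes from [exp(-<x, v>)] being the Laplace transform of a probability on
    the quadrant. *)

(* A Gronwall lemma tolerating atoms, by continuous induction downwards from
   [t]: only the mass [mu q b] of an *open* interval has to become small when
   [q] and [b] get close, since the value at an atom [b] is controlled by what
   happens strictly after [b]. The constant [C] does not depend on [D]. *)
Lemma gronwall (R : realType) (t K : R) (mu : R -> R -> R) :
  0 <= t -> 0 <= K -> (forall a b, 0 <= mu a b) ->
  (forall a q b, 0 <= a -> a <= q -> q <= b -> b <= t -> mu q b <= mu a b) ->
  (forall a q b, 0 <= a -> a <= q -> q <= b -> b <= t -> mu a q <= mu a b) ->
  (forall q, 0 <= q < t -> exists b, q < b <= t /\ mu q b <= 2^-1) ->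
  (forall q, 0 < q <= t -> exists a, 0 <= a < q /\ mu a q <= 2^-1) ->
  exists C, 0 <= C /\ forall (D : R -> R) (A M0 : R), 0 <= A ->
    (forall r, 0 <= r <= t -> 0 <= D r <= M0) ->
    (forall q b M N, 0 <= q -> q <= b -> b <= t -> 0 <= M -> 0 <= N ->
       (forall s, q < s < b -> D s <= M) ->
       (forall s, b <= s <= t -> q < s -> D s <= N) ->
       D q <= A + M * mu q b + N * K) ->
    forall r, 0 <= r <= t -> D r <= C * A.
Proof.
move=> t0 K0 mu0 muL muR smallR smallL.
pose P b := exists C, 0 <= C /\ forall (D : R -> R) (A M0 : R), 0 <= A ->
    (forall r, 0 <= r <= t -> 0 <= D r <= M0) ->
    (forall q b M N, 0 <= q -> q <= b -> b <= t -> 0 <= M -> 0 <= N ->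
       (forall s, q < s < b -> D s <= M) ->
       (forall s, b <= s <= t -> q < s -> D s <= N) ->
       D q <= A + M * mu q b + N * K) ->
    forall r, b <= r <= t -> D r <= C * A.
have step a b : 0 <= a -> a < b -> b <= t -> mu a b <= 2^-1 -> P b -> P a.
  move=> a0 ab bt muab [C [C0 PC]].
  (* With [S] the supremum of [D] over [[a, b)], finite thanks to [M0], and the bound [C * A] on
     [[b, t]], the hypothesis gives [S <= A + S / 2 + C * A * K], hence [S <= 2 * (1 + C * K) * A].
     The last summand [C] covers [r >= b]. *)
  exists (2 * (1 + C * K) + C); split; first by nra.
  move=> D A M0 A0 DM0 H r /andP[ar rt].
  have DC := PC _ _ _ A0 DM0 H.
  have CA0 : 0 <= C * A by exact: mulr_ge0.
  have CAK0 : 0 <= C * A * K by exact: mulr_ge0.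
  have [br|rb] := leP b r.
    by have := DC r; rewrite br rt => /(_ isT); nra.
  pose S := [set D s | s in [set s | a <= s < b]].
  have Sub : has_ubound S.
    exists M0 => _ [s /= /andP[as_ sb] <-].
    have /DM0/andP[]// : 0 <= s <= t.
    by rewrite (le_trans a0 as_) (le_trans (ltW sb)).
  have DS s : a <= s < b -> D s <= sup S.
    by move=> sab; apply: (ub_le_sup Sub); exists s.
  have S0 : 0 <= sup S.
    have /DM0/andP[Dr0 _] : 0 <= r <= t by rewrite (le_trans a0 ar).
    by rewrite (le_trans Dr0)// DS// ar rb.
  have : sup S <= A + sup S * 2^-1 + C * A * K.
    apply: ge_sup; first by exists (D r), r => //=; rewrite ar rb.
    move=> _ [q /= /andP[aq qb] <-].
    have q0 : 0 <= q by exact: le_trans aq.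
    have Dq : D q <= A + sup S * mu q b + C * A * K.
      apply: H => // [|s /andP[qs sb]|s sbt _]; [exact: ltW| |exact: DC].
      by apply: DS; rewrite sb (le_trans aq (ltW qs)).
    have : mu q b <= 2^-1 by apply: le_trans muab; exact: muL (ltW qb) bt.
    move/(ler_wpM2l S0); lra.
  have : D r <= sup S by apply: DS; rewrite ar rb.
  nra.
(* At [r = t] there is no later time: both conditions hold vacuously with [M = N = 0], so
   [D t <= A]. *)
have Pt : P t.
  exists 1; split => // D A M0 A0 DM0 H r /andP[tr rt].
  have -> : r = t by apply/eqP; rewrite eq_le tr rt.
  have := H t t 0 0 t0 (lexx _) (lexx _) (lexx _) (lexx _).
  rewrite !mul0r !addr0 mul1r; apply.
  - by move=> s /andP[ts st]; have := lt_trans ts st; rewrite ltxx.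
  - by move=> s /andP[_ st] ts; have := lt_le_trans ts st; rewrite ltxx.
pose S := [set b | 0 <= b <= t /\ P b].
have Slb : has_lbound S by exists 0 => b [/andP[]].
have St : S t by split; rewrite ?t0 ?lexx.
have inf0 : 0 <= inf S by apply: lb_le_inf; [exists t|move=> b [/andP[]]].
have inft : inf S <= t by exact: ge_inf.
(* The infimum is attained: points of [S] come arbitrarily close to it from above, and [step]
   bridges the gap, which has small [mu] by [smallR]. *)
have Pinf : P (inf S).
  move: inft; rewrite le_eqVlt => /orP[/eqP -> //|inft].
  have [|b [/andP[ib bt] mub]] := smallR (inf S); first by rewrite inf0 inft.
  have b0 : 0 < b - inf S by rewrite subr_gt0.
  have [c [/andP[c0 ct] Pc] cb] : exists2 c, S c & c < inf S + (b - inf S).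
    by apply: inf_adherent => //; split => //; exists t.
  have ic : inf S <= c by apply: ge_inf => //; split => //; rewrite c0 ct.
  move: cb; rewrite addrC subrK => cb.
  move: ic; rewrite le_eqVlt => /orP[/eqP -> //|ic].
  apply: (@step _ c) => //.
  by apply: le_trans mub; apply: muR => //; exact: ltW.
suff i0 : inf S = 0 by move: Pinf; rewrite i0.
(* A positive infimum could be lowered by one more [step], over the interval provided by
   [smallL]. *)
apply/eqP; rewrite eq_le inf0 andbT leNgt; apply/negP => infgt.
have [|a [/andP[a0 ai] mua]] := smallL (inf S); first by rewrite infgt inft.
have Pa := step _ _ a0 ai inft mua Pinf.
have : inf S <= a.
  by apply: ge_inf => //; split => //; rewrite a0 (le_trans (ltW ai)).
by rewrite leNgt ai.
Qed.

(** Since indicators of all measurable sets are available, no pi-system is involved: simple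
    functions and increasing limits suffice. Each step hands over measurability and nonnegativity,
    so that additivity and monotone convergence apply when [Phi] is an identity of integrals. *)
Lemma ge0_measurable_ind d (T : measurableType d) (R : realType)
  (Phi : (T -> \bar R) -> Prop) :
  (forall A, measurable A -> Phi (EFin \o \1_A)) ->
  (forall (k : R) f, 0 <= k -> measurable_fun setT f ->
     (forall x, 0 <= f x)%E -> Phi f -> Phi (fun x => k%:E * f x)%E) ->
  (forall f g, measurable_fun setT f -> measurable_fun setT g ->
     (forall x, 0 <= f x)%E -> (forall x, 0 <= g x)%E ->
     Phi f -> Phi g -> Phi (fun x => f x + g x)%E) ->
  (forall (u : (T -> \bar R)^nat) f, (forall n, measurable_fun setT (u n)) ->
     (forall n x, 0 <= u n x)%E ->
     (forall x, {homo u ^~ x : n m / (n <= m)%N >-> (n <= m)%E}) ->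
     (forall x, u n x @[n --> \oo] --> f x) ->
     (forall n, Phi (u n)) -> Phi f) ->
  forall f, measurable_fun setT f -> (forall x, 0 <= f x)%E -> Phi f.
Proof.
move=> Pind PZ PD Plim f mf f0.
pose u n : T -> \bar R := EFin \o nnsfun_approx measurableT mf n.
apply: (Plim u).
- by move=> n; apply/measurable_EFinP.
- by move=> n x; rewrite lee_fin.
- by move=> x n m nm; rewrite lee_fin; exact/lefP/nd_nnsfun_approx.
- by move=> x; exact: cvg_nnsfun_approx.
move=> n.
rewrite /u; set g := nnsfun_approx _ _ n.
have -> : EFin \o g = (fun x => \sum_(k <- fset_set (range g))
    (k%:E * (\1_(g @^-1` [set k]) x)%:E))%E.
  apply/funext => x; rewrite /= {1}fimfunE fsbig_finite//= -sumEFin.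
  by apply: eq_bigr => k _; rewrite EFinM.
have sub (k : R) : k \in finmap.enum_fset (fset_set (range g)) -> 0 <= k.
  rewrite -[_ \in _]/(k \in fset_set (range g)).
  by rewrite in_fset_set// => /set_mem[x _ <-].
elim: (finmap.enum_fset _) sub => [sub|k s ih sub].
  under eq_fun do rewrite big_nil.
  have -> : (fun=> 0%E) = EFin \o (\1_set0 : T -> R).
    by apply/funext => x /=; rewrite indic0.
  exact: Pind.
under eq_fun do rewrite big_cons.
have mk : measurable_fun setT (fun x => (\1_(g @^-1` [set k]) x)%:E : \bar R).
  by apply/measurable_EFinP; exact: measurable_indic.
have k0 : 0 <= k by apply: sub; rewrite in_cons eqxx.
have s0 : forall j, j \in s -> 0 <= j.
  by move=> j js; apply: sub; rewrite in_cons js orbT.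
apply: PD.
- exact: measurable_funeM.
- by apply: emeasurable_sum => j; apply: measurable_funeM; apply/measurable_EFinP; exact: measurable_indic.
- by move=> x; apply: mule_ge0 => //; rewrite lee_fin.
- move=> x; rewrite big_seq; apply: sume_ge0 => j js.
  by rewrite mule_ge0// lee_fin; exact: s0.
- by apply: PZ => //; exact: Pind.
- exact: ih.
Qed.

(** * The backward integral equation *)

Section IntegralTerms.
Context {R : realType}.
Implicit Types (r s t : R) (w : R -> R * R).

(* One integral of the backward equation: [tphi (w s) q] is integrated over the
   points [q] of [tset] whose time [s = ttime q] lies in [(r, t]]. The weight
   [twt] carries the growth and Lipschitz bounds of [tphi] in its first argument. *)
Record term := Term {
  tdisp : measure_display;
  tsp : measurableType tdisp;
  tms : {measure set tsp -> \bar R};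
  ttime : tsp -> R;
  tset : set tsp;
  tphi : R * R -> tsp -> R;
  twt : tsp -> R }.

Definition tdom (k : term) (B : set R) : set (tsp k) :=
  ttime k @^-1` B `&` tset k.

Definition dist1 (x y : R * R) : R := `|x.1 - y.1| + `|x.2 - y.2|.

(** The two bounds have different roles. [ok_up] is one-sided and linear, with no bound on [x]
    required: a priori estimates rest on it. [ok_lip] is two-sided, but its constant grows with [M],
    so it serves only once solutions are known to be bounded. The constant [2 * M + 2] is chosen to
    fit the linear, quadratic and kernel terms alike. *)
Record term_ok t (k : term) : Prop := TermOk {
  ok_time : measurable_fun setT (ttime k);
  ok_set : measurable (tset k);
  ok_wt0 : forall q, tset k q -> 0 <= twt k q;
  ok_int : (tms k).-integrable (tdom k (Ioc 0 t)) (EFin \o twt k);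
  ok_zero : forall q, tphi k (0, 0) q = 0;
  ok_up : forall x q, Rp2 x -> tset k q -> tphi k x q <= (x.1 + x.2) * twt k q;
  ok_lip : forall M x y q, Rp2 x -> Rp2 y -> x.1 <= M -> x.2 <= M ->
    y.1 <= M -> y.2 <= M -> tset k q ->
    `|tphi k x q - tphi k y q| <= (2 * M + 2) * dist1 x y * twt k q }.

Definition tfun (k : term) w (q : tsp k) : R := tphi k (w (ttime k q)) q.

Definition tintegrable k w r s :=
  (tms k).-integrable (tdom k (Ioc r s)) (EFin \o tfun k w).

Definition tint k w r s : R := \int[tms k]_(q in tdom k (Ioc r s)) tfun k w q.

(** The intersection with [Ioc 0 t] keeps the mass finite for every measurable [B], so that [setT]
    can stand for the whole time interval. *)
Definition tmass t k (B : set R) : R :=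
  \int[tms k]_(q in tdom k (B `&` Ioc 0 t)) twt k q.

Lemma tdom_measurable t k B : term_ok t k -> measurable B ->
  measurable (tdom k B).
Proof.
move=> tk mB; apply: measurableI; last exact: ok_set tk.
by rewrite -[X in measurable X]setTI; exact: (ok_time _ _ tk).
Qed.

Lemma tdomS k A B : A `<=` B -> tdom k A `<=` tdom k B.
Proof. by move=> AB q [/AB]. Qed.

Lemma tdomU k A B : tdom k (A `|` B) = tdom k A `|` tdom k B.
Proof. by rewrite /tdom preimage_setU setIUl. Qed.

Lemma tdom_disj k A B : [disjoint A & B] -> [disjoint tdom k A & tdom k B].
Proof.
move=> /disj_setPS AB; apply/disj_setPS => q [[qA _] [qB _]].
by have := AB (ttime k q); apply.
Qed.

Lemma measurable_Ioc r s : measurable (Ioc r s).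
Proof. exact: measurable_itv. Qed.

Lemma Ioc_split r s t : r <= s -> s <= t -> Ioc r t = Ioc r s `|` Ioc s t.
Proof.
move=> rs st; rewrite predeqE => x; rewrite /Ioc/= !in_itv/=; split.
- by move=> /andP[rx xt]; have [xs|sx] := leP x s; [left|right]; apply/andP.
- move=> [/andP[rx xs]|/andP[sx xt]].
  + by rewrite rx (le_trans xs).
  + by rewrite xt (le_lt_trans rs).
Qed.

Lemma Ioc_disj r s t : [disjoint Ioc r s & Ioc s t].
Proof.
apply/disj_setPS => x; rewrite /Ioc/= !in_itv/= => -[/andP[_ xs] /andP[sx _]].
by have := le_lt_trans xs sx; rewrite ltxx.
Qed.

Lemma integrable_setU d (T : measurableType d) (m : {measure set T -> \bar R})
    (A B : set T) (f : T -> \bar R) : measurable A -> measurable B ->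
  m.-integrable A f -> m.-integrable B f -> m.-integrable (A `|` B) f.
Proof.
move=> mA mB fA fB.
have mf : measurable_fun (A `|` B) f.
  by apply/measurable_funU => //; split; [exact: measurable_int fA|exact: measurable_int fB].
apply/integrableP; split => //.
have AB : A `|` B = A `|` (B `\` A).
  apply/seteqP; split=> x [Ax|]; [by left| |by left|by move=> [Bx _]; right].
  by move=> Bx; have [Ax|nAx] := pselect (A x); [left|right].
rewrite AB.
have mBA := measurableD mB mA.
rewrite ge0_integral_setU//=.
- have /integrableP[_ ?] := fA.
  have /integrableP[_ ?] : m.-integrable (B `\` A) f.
    by apply: integrableS fB => //; exact: subDsetl.
  exact: lte_add_pinfty.
- apply: measurableT_comp => //; apply: measurable_funS mf => //.
  - exact: measurableU.
  - by rewrite -AB.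
- by apply/disj_setPS => x [Ax [_]].
Qed.

Lemma tint_split t0 k w r s t : term_ok t0 k -> r <= s -> s <= t ->
  tintegrable k w r s -> tintegrable k w s t ->
  tintegrable k w r t /\ tint k w r t = tint k w r s + tint k w s t.
Proof.
move=> tk rs st irs ist.
have m1 := tdom_measurable _ _ _ tk (measurable_Ioc r s).
have m2 := tdom_measurable _ _ _ tk (measurable_Ioc s t).
have irt : tintegrable k w r t.
  by rewrite /tintegrable (Ioc_split _ s)// tdomU; exact: integrable_setU.
split=> //; rewrite /tint (Ioc_split _ s)// tdomU Rintegral_setU//.
- by rewrite -tdomU -Ioc_split.
- by apply: tdom_disj; exact: Ioc_disj.
Qed.

(** Comparison with the zero function through [ok_lip] and [ok_zero] dominates every integrand by
    [(2 * M + 2) * (2 * M) * twt]. A uniform bound and pointwise convergence are therefore enough;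
    integrability of the limit comes out of dominated convergence. *)
Lemma tint_cvg t k (u : (R -> R * R)^nat) w r s (M : R) :
  term_ok t k -> 0 <= r -> s <= t -> 0 <= M ->
  (forall n, tintegrable k (u n) r s) ->
  (forall n x, r < x <= s -> [/\ Rp2 (u n x), (u n x).1 <= M & (u n x).2 <= M]) ->
  (forall x, r < x <= s -> [/\ Rp2 (w x), (w x).1 <= M & (w x).2 <= M]) ->
  (forall x, r < x <= s -> (u n x).1 @[n --> \oo] --> (w x).1) ->
  (forall x, r < x <= s -> (u n x).2 @[n --> \oo] --> (w x).2) ->
  tintegrable k w r s /\ tint k (u n) r s @[n --> \oo] --> tint k w r s.
Proof.
move=> tk r0 st M0 iu uM wM u1 u2.
have mD := tdom_measurable _ _ _ tk (measurable_Ioc r s).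
have itau q : tdom k (Ioc r s) q -> r < ttime k q <= s.
  by move=> [+ _]; rewrite /Ioc/= in_itv.
have cvu q : tdom k (Ioc r s) q -> tfun k (u n) q @[n --> \oo] --> tfun k w q.
  move=> Dq; have tq := itau _ Dq; have [_ Sq] := Dq.
  apply/subr_cvg0/norm_cvg0P.
  have [wR wM1 wM2] := wM _ tq.
  apply: (@squeeze_cvgr _ _ _ _ (cst 0)
    (fun n => (2 * M + 2) * dist1 (u n (ttime k q)) (w (ttime k q)) * twt k q)).
  - apply: nearW => n; have [uR uM1 uM2] := uM n _ tq.
    by rewrite normr_ge0/= /tfun; exact: (ok_lip _ _ tk).
  - exact: cvg_cst.
  - rewrite -[X in _ --> X](mul0r (twt k q)); apply: cvgMl.
    rewrite -[X in _ --> X](mulr0 (2 * M + 2)); apply: cvgMr.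
    rewrite -[X in _ --> X](addr0 0); apply: cvgD.
    + by apply/norm_cvg0P/subr_cvg0; exact: u1.
    + by apply/norm_cvg0P/subr_cvg0; exact: u2.
have ig : (tms k).-integrable (tdom k (Ioc r s))
    (fun q => ((2 * M + 2) * (2 * M) * twt k q)%:E).
  apply: (@eq_integrable _ _ _ _ _ mD
    (fun q => (((2 * M + 2) * (2 * M))%:E * (twt k q)%:E)%E)).
    by move=> q _; rewrite -EFinM.
  apply: integrableZl => //; apply: integrableS (ok_int _ _ tk) => //.
  - exact: tdom_measurable tk (measurable_Ioc _ _).
  - apply: tdomS => x; rewrite /Ioc/= !in_itv/= => /andP[rx xs].
    by rewrite (le_lt_trans r0 rx) (le_trans xs).
have bu n q : tdom k (Ioc r s) q ->
    `|tfun k (u n) q| <= (2 * M + 2) * (2 * M) * twt k q.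
  move=> Dq; have tq := itau _ Dq; have [_ Sq] := Dq.
  have [uR uM1 uM2] := uM n _ tq.
  rewrite -[X in `|X|]subr0 -(ok_zero _ _ tk q).
  have R0 : Rp2 ((0, 0) : R * R) by split => /=.
  apply: le_trans (ok_lip _ _ tk M _ (0, 0) _ uR R0 uM1 uM2 M0 M0 Sq) _.
  apply: ler_wpM2r; first exact: (ok_wt0 _ _ tk).
  apply: ler_wpM2l; first lra.
  rewrite /dist1/= !subr0; have [u1r u2r] := uR.
  by rewrite !ger0_norm//; lra.
have [] := @dominated_convergence _ _ _ (tms k) _ mD
  (fun n => EFin \o tfun k (u n)) (EFin \o tfun k w) _ _ _ _ ig.
- by move=> n; exact: measurable_int (iu n).
- apply: (emeasurable_fun_cvg (fun n => EFin \o tfun k (u n))) => //.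
  + by move=> n; exact: measurable_int (iu n).
  + by move=> q Dq; apply: cvg_EFin; [exact: nearW|exact: cvu].
- by apply: aeW => q Dq; apply: cvg_EFin; [exact: nearW|exact: cvu].
- by apply: aeW => q n Dq; rewrite lee_fin; exact: bu.
move=> iw _ cw; split => //.
by apply: fine_cvg; rewrite /tint /Rintegral fineK//; exact: integrable_fin_num.
Qed.

Lemma tmass_ge0 t k B : term_ok t k -> 0 <= tmass t k B.
Proof. by move=> tk; apply: Rintegral_ge0 => q [_ Sq]; exact: (ok_wt0 _ _ tk). Qed.

Lemma wt_integrable t k B : term_ok t k -> measurable B ->
  (tms k).-integrable (tdom k (B `&` Ioc 0 t)) (EFin \o twt k).
Proof.
move=> tk mB; apply: integrableS (ok_int _ _ tk).
- exact: tdom_measurable tk (measurable_Ioc _ _).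
- by apply: tdom_measurable tk _; apply: measurableI => //; exact: measurable_Ioc.
- by apply: tdomS; exact: subIsetr.
Qed.

Lemma tmassS t k A B : term_ok t k -> measurable A -> measurable B ->
  A `<=` B -> tmass t k A <= tmass t k B.
Proof.
move=> tk mA mB AB; have iA := wt_integrable _ _ _ tk mA.
have iB := wt_integrable _ _ _ tk mB.
have mI C : measurable C -> measurable (tdom k (C `&` Ioc 0 t)).
  move=> mC; apply: tdom_measurable tk _.
  by apply: measurableI => //; exact: measurable_Ioc.
apply: fine_le; [by apply: integrable_fin_num => //; exact: mI..|].
apply: ge0_subset_integral; [exact: mI|exact: mI| | |].
- exact: measurable_int iB.
- by move=> q [_ Sq]; rewrite lee_fin; exact: (ok_wt0 _ _ tk).
- by apply: tdomS; exact: setSI.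
Qed.

(** The sets vanish pointwise but need not decrease, so continuity from above is replaced by
    dominated convergence, with [twt] as dominating function. *)
Lemma tmass_cvg0 t k (B : (set R)^nat) : term_ok t k ->
  (forall n, measurable (B n)) -> (forall x, \forall n \near \oo, ~ B n x) ->
  tmass t k (B n) @[n --> \oo] --> 0.
Proof.
move=> tk mB B0.
have mD := tdom_measurable _ _ _ tk (measurable_Ioc 0 t).
have mDB n : measurable (tdom k (B n)) by exact: tdom_measurable tk _.
have E n : tmass t k (B n) =
    fine (\int[tms k]_(q in tdom k (Ioc 0 t)) ((EFin \o twt k) \_ (tdom k (B n))) q)%E.
  rewrite /tmass /Rintegral -integral_mkcondr; congr (fine (integral _ _ _)).
  by apply/seteqP; split => q; rewrite /tdom/=; tauto.
rewrite (funext E); apply: (@fine_cvg _ _ _ _ _ 0).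
have <- : (\int[tms k]_(x in tdom k (Ioc 0 t)) 0 = 0%:E)%E by rewrite integral0.
apply: (@dominated_cvg _ _ _ _ _ mD _ _ (EFin \o twt k)) => //.
- move=> n; apply/(measurable_restrict _ (mDB n) mD).
  apply: measurable_funS (measurable_int _ (ok_int _ _ tk)) => //.
- move=> q Dq; apply: cvg_near_cst.
  near=> n; rewrite patchE memNset// => -[Bq _].
  by move: Bq; near: n; exact: B0.
- exact: ok_int tk.
- move=> n q [_ Sq]; rewrite patchE; case: ifPn => _.
    by rewrite /= ger0_norm//; exact: (ok_wt0 _ _ tk).
  by rewrite abse0 lee_fin; exact: (ok_wt0 _ _ tk).
Unshelve. all: by end_near. Qed.

Lemma tint_le t k h B c : term_ok t k -> measurable B -> B `<=` Ioc 0 t ->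
  (tms k).-integrable (tdom k B) (EFin \o h) ->
  (forall x, tdom k B x -> h x <= c * twt k x) ->
  \int[tms k]_(x in tdom k B) h x <= c * tmass t k B.
Proof.
move=> tk mB Bt ih hc; have iB := wt_integrable _ _ B tk mB.
rewrite /tmass; move: iB; rewrite (setIidl Bt) => iB.
have mD := tdom_measurable _ _ _ tk mB.
rewrite -RintegralZl//; apply: le_Rintegral => //.
by apply: (@eq_integrable _ _ _ _ _ mD (fun q => (c%:E * (twt k q)%:E)%E)) => //;
   exact: integrableZl.
Qed.

(* Puts the equation in the form required by [gronwall]. *)
Lemma tint_bound t k h (D : R -> R) q b M N : term_ok t k ->
  0 <= q -> q <= b -> b <= t -> 0 <= M -> 0 <= N ->
  (tms k).-integrable (tdom k (Ioc q t)) (EFin \o h) ->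
  (forall x, tdom k (Ioc q t) x -> h x <= D (ttime k x) * twt k x) ->
  (forall s, q < s < b -> D s <= M) ->
  (forall s, b <= s <= t -> q < s -> D s <= N) ->
  \int[tms k]_(x in tdom k (Ioc q t)) h x
    <= M * tmass t k `]q, b[%classic + N * tmass t k setT.
Proof.
move=> tk q0 qb bt M0 N0 ih hD DM DN.
have mqb : measurable (`]q, b[%classic : set R) by exact: measurable_itv.
have mB := measurableD (measurable_Ioc q t) mqb.
have sub1 : `]q, b[%classic `<=` Ioc q t.
  move=> x; rewrite /Ioc/= !in_itv/= => /andP[-> xb] /=.
  exact: le_trans (ltW xb) bt.
have sub2 : Ioc q t `\` `]q, b[%classic `<=` Ioc q t by exact: subDsetl.
have sub0 : Ioc q t `<=` Ioc 0 t.
  move=> x; rewrite /Ioc/= !in_itv/= => /andP[qx ->].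
  by rewrite (le_lt_trans q0 qx).
have E : Ioc q t = `]q, b[%classic `|` (Ioc q t `\` `]q, b[%classic).
  by rewrite setDUK.
have m1 := tdom_measurable _ _ _ tk mqb.
have m2 := tdom_measurable _ _ _ tk mB.
have m0 := tdom_measurable _ _ _ tk (measurable_Ioc q t).
rewrite {1}E tdomU Rintegral_setU//; last first.
- by apply: tdom_disj; apply/disj_setPS => x [? []].
- by rewrite -tdomU -E.
apply: lerD.
  apply: (tint_le _ _ _ _ _ tk) => //.
  - exact: subset_trans sub0.
  - by apply: integrableS ih => //; exact: tdomS.
  - move=> x Dx; apply: le_trans (hD _ _) _; first exact: tdomS Dx.
    have [qx Sx] := Dx; apply: ler_wpM2r; first exact: (ok_wt0 _ _ tk).
    by apply: DM; move: qx; rewrite /= in_itv.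
apply: (@le_trans _ _ (N * tmass t k (Ioc q t `\` `]q, b[%classic))).
  apply: (tint_le _ _ _ _ _ tk) => //.
  - exact: subset_trans sub0.
  - by apply: integrableS ih => //; exact: tdomS.
  - move=> x Dx; apply: le_trans (hD _ _) _; first exact: tdomS Dx.
    have [[qx nqx] Sx] := Dx; apply: ler_wpM2r; first exact: (ok_wt0 _ _ tk).
    move: qx nqx; rewrite /Ioc/= !in_itv/= => /andP[qx xt] /negP.
    by rewrite qx/= -leNgt => bx; apply: DN => //; rewrite bx.
by apply: ler_wpM2l => //; exact: tmassS.
Qed.

End IntegralTerms.

Lemma cvg_bigsum (R : realType) (I : Type) (l : seq I) (f : I -> nat -> R)
    (a : I -> R) : (forall i, f i n @[n --> \oo] --> a i) ->
  \sum_(i <- l) f i n @[n --> \oo] --> \sum_(i <- l) a i.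
Proof.
move=> fa; elim: l => [|i l ih].
  by rewrite big_nil; under eq_fun do rewrite big_nil; exact: cvg_cst.
by rewrite big_cons; under eq_fun do rewrite big_cons; exact: cvgD.
Qed.

Lemma near_natSinv_lt (R : realType) (e : R) : 0 < e ->
  \forall n \near \oo, n.+1%:R^-1 < e.
Proof. by move=> e0; exact: (near_infty_natSinv_lt (PosNum e0)). Qed.

(** * A priori bound and uniqueness for nonnegative solutions *)

Section Solutions.
Context {R : realType}.
Variables (t : R) (ts : 'I_2 -> 'I_5 -> @term R).
Hypothesis t0 : 0 <= t.
Hypothesis tok : forall i k, term_ok t (ts i k).
Implicit Types (w : R -> R * R).

(** Integrability is a separate clause because the real-valued [tint] would otherwise hide an
    infinite or undefined integral behind a default value. *)
Definition sol (a : 'I_2 -> R -> R) w := forall r, 0 <= r <= t -> forall i : 'I_2,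
  (forall k, tintegrable (ts i k) w r t) /\
  crd (w r) i = a i r + \sum_(k < 5) tint (ts i k) w r t.

Definition total_mass (B : set R) : R :=
  \sum_(i < 2) \sum_(k < 5) tmass t (ts i k) B.

Lemma total_mass_ge0 B : 0 <= total_mass B.
Proof. by apply: sumr_ge0 => i _; apply: sumr_ge0 => k _; exact: tmass_ge0. Qed.

Lemma total_massS A B : measurable A -> measurable B -> A `<=` B ->
  total_mass A <= total_mass B.
Proof.
by move=> mA mB AB; apply: ler_sum => i _; apply: ler_sum => k _; exact: tmassS.
Qed.

Lemma total_mass_cvg0 (B : (set R)^nat) : (forall n, measurable (B n)) ->
  (forall x, \forall n \near \oo, ~ B n x) -> total_mass (B n) @[n --> \oo] --> 0.
Proof.
move=> mB B0.
have -> : 0 = \sum_(i < 2) \sum_(k < 5) (0 : R).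
  by rewrite big1// => i _; rewrite big1.
by apply: cvg_bigsum => i; apply: cvg_bigsum => k; exact: tmass_cvg0.
Qed.

(** Smallness of the mass on either side of [q] holds because []q, q + 1/(n+1)[] and []q - 1/(n+1),
    q[] shrink to the empty set; intervals containing [q] would keep a possible atom there. The
    factor [L] is 1 for the a priori bound and the Lipschitz constant for uniqueness. *)
Lemma sol_gronwall (L : R) : 0 <= L ->
  exists C, 0 <= C /\ forall (D : R -> R) (A M0 : R), 0 <= A ->
    (forall r, 0 <= r <= t -> 0 <= D r <= M0) ->
    (forall q b M N, 0 <= q -> q <= b -> b <= t -> 0 <= M -> 0 <= N ->
       (forall s, q < s < b -> D s <= M) ->
       (forall s, b <= s <= t -> q < s -> D s <= N) ->
       D q <= A + M * (L * total_mass `]q, b[%classic)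
                + N * (L * total_mass setT)) ->
    forall r, 0 <= r <= t -> D r <= C * A.
Proof.
move=> L0; have moo (a b : R) : measurable (`]a, b[%classic : set R).
  exact: measurable_itv.
have Sl (a b c : R) : a <= b -> total_mass `]b, c[%classic <= total_mass `]a, c[%classic.
  move=> ab; apply: total_massS => // x; rewrite /= !in_itv/= => /andP[bx ->].
  by rewrite (le_lt_trans ab bx).
have Sr (a b c : R) : b <= c -> total_mass `]a, b[%classic <= total_mass `]a, c[%classic.
  move=> ab; apply: total_massS => // x; rewrite /= !in_itv/= => /andP[-> bx]/=.
  exact: lt_le_trans ab.
apply: (@gronwall R t (L * total_mass setT) (fun x y => L * total_mass `]x, y[%classic)) => //.
- by apply: mulr_ge0 => //; exact: total_mass_ge0.
- by move=> a b; apply: mulr_ge0 => //; exact: total_mass_ge0.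
- by move=> a q b _ aq _ _; apply: ler_wpM2l => //; exact: Sl.
- by move=> a q b _ _ qb _; apply: ler_wpM2l => //; exact: Sr.
- move=> q /andP[q0 qt].
  have : L * total_mass `]q, q + n.+1%:R^-1[%classic @[n --> \oo] --> 0.
    rewrite -[X in _ --> X](mulr0 L); apply: cvgMr; apply: total_mass_cvg0 => // x.
    have [xq|qx] := leP x q.
      by apply: nearW => n; rewrite /= in_itv/= ltNge xq.
    have xq0 : 0 < x - q by rewrite subr_gt0.
    apply: filterS (near_natSinv_lt _ _ xq0) => n nx.
    by rewrite /= in_itv/= => /andP[_]; move: (_^-1) nx => h; lra.
  move=> /cvgr_lt/(_ 2^-1); rewrite invr_gt0 ltr0n => /(_ isT)/filter_ex[n nL].
  exists (Num.min (q + n.+1%:R^-1) t); split.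
    by rewrite lt_min qt ge_min lexx orbT ltrDl invr_gt0 ltr0n.
  apply: le_trans (ltW nL); apply: ler_wpM2l => //; apply: Sr.
  by rewrite ge_min lexx.
- move=> q /andP[q0 qt].
  have : L * total_mass `]q - n.+1%:R^-1, q[%classic @[n --> \oo] --> 0.
    rewrite -[X in _ --> X](mulr0 L); apply: cvgMr; apply: total_mass_cvg0 => // x.
    have [qx|xq] := leP q x.
      by apply: nearW => n; rewrite /= in_itv/= [x < q]ltNge qx andbF.
    have xq0 : 0 < q - x by rewrite subr_gt0.
    apply: filterS (near_natSinv_lt _ _ xq0) => n nx.
    by rewrite /= in_itv/= => /andP[+ _]; move: (_^-1) nx => h; lra.
  move=> /cvgr_lt/(_ 2^-1); rewrite invr_gt0 ltr0n => /(_ isT)/filter_ex[n nL].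
  exists (Num.max (q - n.+1%:R^-1) 0); split.
    by rewrite gt_max q0 le_max lexx orbT ltrBlDr ltrDl invr_gt0 ltr0n.
  apply: le_trans (ltW nL); apply: ler_wpM2l => //; apply: Sl.
  by rewrite le_max lexx.
Qed.

Lemma sum_crd (x : R * R) : \sum_(i < 2) crd x i = x.1 + x.2.
Proof. by rewrite !big_ord_recl big_ord0 addr0. Qed.

Lemma crd_ge0 (x : R * R) i : Rp2 x -> 0 <= crd x i.
Proof. by move=> [x1 x2]; rewrite /crd; case: ifP. Qed.

(** This bound depends on [w]: each term over [(r, t]] is at most its absolute integral over
    [(0, t]], finite by integrability at [r = 0]. It supplies the finite [M0] that [sol_gronwall]
    requires, and the square on which [ok_lip] is used for uniqueness. *)
Lemma sol_bounded (a : 'I_2 -> R -> R) w (A : R) :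
  (forall (r : R) i, 0 <= r <= t -> a i r <= A) ->
  (forall r : R, 0 <= r <= t -> Rp2 (w r)) -> sol a w ->
  exists M, forall r, 0 <= r <= t -> (w r).1 + (w r).2 <= M.
Proof.
move=> aA w0 sw.
exists (\sum_(i < 2) (A + \sum_(k < 5)
  \int[tms (ts i k)]_(q in tdom (ts i k) (Ioc 0 t)) `|tfun (ts i k) w q|)).
move=> r rt; rewrite -sum_crd; apply: ler_sum => i _.
have [ig ->] := sw r rt i.
have [ig0 _] := sw 0 (introT andP (conj (lexx 0) t0)) i.
apply: lerD; first exact: aA.
apply: ler_sum => k _; apply: le_trans (ler_norm _) _.
have m1 := tdom_measurable _ _ _ (tok i k) (measurable_Ioc r t).
have m0 := tdom_measurable _ _ _ (tok i k) (measurable_Ioc 0 t).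
have sub : tdom (ts i k) (Ioc r t) `<=` tdom (ts i k) (Ioc 0 t).
  apply: tdomS => x; rewrite /Ioc/= !in_itv/= => /andP[rx ->].
  by have /andP[r0 _] := rt; rewrite (le_lt_trans r0 rx).
apply: le_trans (le_normr_Rintegral m1 (ig k)) _.
have in0 := integrable_norm (ig0 k).
apply: fine_le.
- by apply: (@integrable_fin_num _ _ _ _ _ m1); exact: (integrable_norm (ig k)).
- exact: (@integrable_fin_num _ _ _ _ _ m0 _ in0).
- apply: ge0_subset_integral => //; exact: measurable_int in0.
Qed.

(** The coupled system closes in the sum of the coordinates, because [ok_up] bounds every term by
    that sum. [C] depends neither on the forcing nor on [w]; its factor 2 arises because the
    forcings of both coordinates enter the sum. *)
Lemma sol_apriori : exists C, 0 <= C /\ forall (a : 'I_2 -> R -> R) w (A : R), 0 <= A ->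
  (forall (r : R) i, 0 <= r <= t -> a i r <= A) ->
  (forall r : R, 0 <= r <= t -> Rp2 (w r)) -> sol a w ->
  forall r, 0 <= r <= t -> (w r).1 + (w r).2 <= C * A.
Proof.
have [C [C0 HC]] := sol_gronwall 1 ler01.
exists (2 * C); split; first lra.
move=> a w A A0 aA w0 sw; have [M0 wM0] := sol_bounded _ _ _ aA w0 sw.
suff H : forall r, 0 <= r <= t -> (w r).1 + (w r).2 <= C * (2 * A).
  by move=> r /H; lra.
apply: (HC _ _ M0); first lra.
  by move=> r rt; have [w1 w2] := w0 _ rt; rewrite wM0// addr_ge0.
move=> q b M N q0 qb bt M_0 N_0 DM DN; rewrite !mul1r -sum_crd.
have qt : 0 <= q <= t by rewrite q0 (le_trans qb).
apply: (@le_trans _ _ (\sum_(i < 2) (A + \sum_(k < 5)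
  (M * tmass t (ts i k) `]q, b[%classic + N * tmass t (ts i k) setT)))).
  apply: ler_sum => i _; have [ig ->] := sw q qt i.
  apply: lerD; first exact: aA.
  apply: ler_sum => k _.
  apply: (tint_bound _ _ _ (fun s => (w s).1 + (w s).2) _ _ _ _ (tok i k)) => //.
  - exact: ig.
  - move=> x [xq Sx]; apply: (ok_up _ _ (tok i k)) => //; apply: w0.
    by move: xq; rewrite /Ioc/= in_itv/= => /andP[/ltW/(le_trans q0)-> ->].
rewrite (_ : 2 * A = A + A); last lra.
rewrite big_split/= sumr_const card_ord mulr2n -!addrA !lerD2l.
rewrite /total_mass !mulr_sumr -big_split/=; apply: ler_sum => i _.
by rewrite !mulr_sumr -big_split.
Qed.

(** The forcing cancels in the difference, so the Gronwall lemma applies to [dist1] with [A = 0].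
    The Lipschitz constant is taken on the square [[0, B]^2], which contains both solutions. *)
Lemma sol_unique (a : 'I_2 -> R -> R) w w' (A : R) :
  (forall (r : R) i, 0 <= r <= t -> a i r <= A) ->
  (forall r : R, 0 <= r <= t -> Rp2 (w r)) -> sol a w ->
  (forall r : R, 0 <= r <= t -> Rp2 (w' r)) -> sol a w' ->
  forall r, 0 <= r <= t -> w r = w' r.
Proof.
move=> aA w0 sw w0' sw'.
have [M1 wM1] := sol_bounded _ _ _ aA w0 sw.
have [M2 wM2] := sol_bounded _ _ _ aA w0' sw'.
pose B := `|M1| + `|M2|.
have B0 : 0 <= B by rewrite addr_ge0.
have wB r : 0 <= r <= t -> [/\ (w r).1 <= B, (w r).2 <= B, (w' r).1 <= B & (w' r).2 <= B].
  move=> rt; have [p1 p2] := w0 _ rt; have [p1' p2'] := w0' _ rt.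
  have := wM1 _ rt; have := wM2 _ rt; have := ler_norm M1; have := ler_norm M2.
  have := normr_ge0 M1; have := normr_ge0 M2; rewrite /B => *.
  by split; lra.
pose L := 2 * B + 2.
have L0 : 0 <= L by rewrite /L; lra.
have [C [C0 HC]] := sol_gronwall L L0.
have H : forall r, 0 <= r <= t -> dist1 (w r) (w' r) <= C * 0.
  apply: (HC _ _ (4 * B)) => //.
    move=> r rt; rewrite addr_ge0//=; have [b1 b2 b1' b2'] := wB _ rt.
    have [p1 p2] := w0 _ rt; have [p1' p2'] := w0' _ rt.
    rewrite /dist1 (_ : 4 * B = 2 * B + 2 * B); last lra.
    by apply: lerD; rewrite ler_norml; apply/andP; split; lra.
  move=> q b M N q0 qb bt M_0 N_0 DM DN; rewrite add0r.
  have qt : 0 <= q <= t by rewrite q0 (le_trans qb).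
  have -> : dist1 (w q) (w' q) = \sum_(i < 2) `|crd (w q) i - crd (w' q) i|.
    by rewrite !big_ord_recl big_ord0 addr0.
  apply: (@le_trans _ _ (\sum_(i < 2) (\sum_(k < 5)
      (L * M * tmass t (ts i k) `]q, b[%classic + L * N * tmass t (ts i k) setT)))).
    apply: ler_sum => i _; have [ig ->] := sw q qt i; have [ig' ->] := sw' q qt i.
    rewrite opprD addrACA subrr add0r -sumrB.
    apply: le_trans (ler_norm_sum _ _ _) _; apply: ler_sum => k _.
    have m1 := tdom_measurable _ _ _ (tok i k) (measurable_Ioc q t).
    rewrite /tint -RintegralB//; [|exact: ig|exact: ig'].
    have igB : (tms (ts i k)).-integrable (tdom (ts i k) (Ioc q t))
        (EFin \o (fun x => tfun (ts i k) w x - tfun (ts i k) w' x)).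
      by apply: (integrableB m1 (ig k) (ig' k)).
    apply: le_trans (le_normr_Rintegral m1 igB) _.
    apply: (tint_bound _ _ _ (fun s => L * dist1 (w s) (w' s)) _ _ _ _ (tok i k)) => //.
    - exact: mulr_ge0.
    - exact: mulr_ge0.
    - exact: integrable_norm.
    - move=> x [xq Sx].
      have xt : 0 <= ttime (ts i k) x <= t.
        by move: xq; rewrite /Ioc/= in_itv/= => /andP[/ltW/(le_trans q0)-> ->].
      have [b1 b2 b1' b2'] := wB _ xt.
      by apply: (ok_lip _ _ (tok i k)) => //; [exact: w0|exact: w0'].
    - by move=> s /DM; exact: ler_wpM2l.
    - by move=> s sb qs; apply: ler_wpM2l => //; exact: DN.
  rewrite !mulrA [M * L]mulrC [N * L]mulrC.
  rewrite /total_mass !mulr_sumr -big_split/=; apply: ler_sum => i _.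
  by rewrite !mulr_sumr -big_split.
move=> r rt; have := H r rt; rewrite mulr0 /dist1 => d0.
have n1 := normr_ge0 ((w r).1 - (w' r).1).
have n2 := normr_ge0 ((w r).2 - (w' r).2).
have e1 : `|(w r).1 - (w' r).1| = 0 by lra.
have e2 : `|(w r).2 - (w' r).2| = 0 by lra.
move/eqP: e1; move/eqP: e2; rewrite !normr_eq0 !subr_eq0 => /eqP e2 /eqP e1.
by rewrite [w r]surjective_pairing [w' r]surjective_pairing e1 e2.
Qed.

End Solutions.

(** * Coefficients of the branching equation *)

Section ConcreteTerms.
Context {R : realType}.
Implicit Types (r s t : R) (w : R -> R * R) (p : tcbve_params R).

Lemma crd_dist1 (x y : R * R) i : `|crd x i - crd y i| <= dist1 x y.
Proof. by rewrite /crd /dist1; case: ifP => _; rewrite ?lerDl ?lerDr. Qed.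

Lemma dist1_ge0 (x y : R * R) : 0 <= dist1 x y.
Proof. by rewrite addr_ge0. Qed.

Lemma crd_le (x : R * R) i M : x.1 <= M -> x.2 <= M -> crd x i <= M.
Proof. by rewrite /crd; case: ifP. Qed.

Lemma crd_sum_le (x : R * R) i : Rp2 x -> crd x i <= x.1 + x.2.
Proof. by move=> [x1 x2]; rewrite /crd; case: ifP => _; lra. Qed.

Lemma crd_oth (x : R * R) i : crd x i + crd x (oth i) = x.1 + x.2.
Proof. by rewrite /crd /oth; case: (i == ord0); rewrite //= addrC. Qed.

Lemma dotp_crd (x y : R * R) i :
  dotp x y = crd x i * crd y i + crd x (oth i) * crd y (oth i).
Proof. by rewrite /dotp /crd /oth; case: (i == ord0); rewrite //= addrC. Qed.

Lemma dist1_crd (x y : R * R) i :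
  dist1 x y = `|crd x i - crd y i| + `|crd x (oth i) - crd y (oth i)|.
Proof. by rewrite /dist1 /crd /oth; case: (i == ord0); rewrite //= addrC. Qed.

Lemma enorm_crd (z : R * R) i :
  enorm z = Num.sqrt (crd z i ^+ 2 + crd z (oth i) ^+ 2).
Proof. by rewrite /enorm /crd /oth; case: (i == ord0); rewrite //= addrC. Qed.

Lemma mom_ge0 i (z : R * R) : Rp2 z -> 0 <= mom i z.
Proof.
move=> z0; rewrite /mom; apply: addr_ge0; last exact: crd_ge0.
by case: ifP => _; rewrite ?sqr_ge0// crd_ge0.
Qed.

Lemma Kfun0 i (z : R * R) : Kfun i (0, 0) z = 0.
Proof. by rewrite /Kfun /dotp /crd /= if_same !mul0r !addr0 oppr0 expR0 subrr. Qed.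

(** Convexity: [exp(-u) >= 1 - u] cancels [x_i z_i] and leaves [- K_i <= x_j z_j]. This is dominated
    by [mom], which contains [z_j] to the first power for small jumps too. *)
Lemma Kfun_lower i (x z : R * R) : Rp2 x -> Rp2 z ->
  - Kfun i x z <= (x.1 + x.2) * mom i z.
Proof.
move=> x0 z0; rewrite /Kfun (dotp_crd _ _ i) -(crd_oth x i) /mom.
have xi := crd_ge0 _ i x0; have xj := crd_ge0 _ (oth i) x0.
have zi := crd_ge0 _ i z0; have zj := crd_ge0 _ (oth i) z0.
have := expR_ge1Dx (- (crd x i * crd z i + crd x (oth i) * crd z (oth i))).
have : 0 <= (crd x i + crd x (oth i)) * (if enorm z <= 1 then crd z i ^+ 2 else crd z i).
  by apply: mulr_ge0; [lra|case: ifP => _; rewrite ?sqr_ge0].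
have := mulr_ge0 xi zj.
rewrite [(_ + _) * (_ + _)]mulrDr [(_ + _) * crd z (oth i)]mulrDl.
by move: (_ * (if _ then _ else _)) (expR _) => u e; lra.
Qed.

(* The derivative [1 - expR (- u)] of [u + expR (- u)] is at most [min 1 m] on
   [[0, m]]; the bound [m] serves for small jumps, the bound [1] for large ones. *)
Lemma expR_second_order (a b m : R) : 0 <= a -> 0 <= b -> a <= m -> b <= m ->
  `|expR (- a) - expR (- b) + (a - b)| <= `|a - b| * Num.min 1 m.
Proof.
wlog ab : a b / b <= a.
  move=> H a0 b0 am bm; have [ba|/ltW ab] := leP b a; first exact: H.
  have := H _ _ ab b0 a0 bm am.
  have -> : expR (- b) - expR (- a) + (b - a) = - (expR (- a) - expR (- b) + (a - b)).
    by ring.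
  by rewrite normrN (distrC b a).
move=> a0 b0 am bm.
have d0 : 0 <= a - b by lra.
rewrite (ger0_norm d0).
have e1 : expR (- a) >= expR (- b) * (1 - (a - b)).
  have -> : - a = - b + - (a - b) by ring.
  by rewrite expRD ler_wpM2l ?expR_ge0// expR_ge1Dx.
have e2 : expR (- b) >= expR (- a) * (1 + (a - b)).
  rewrite (_ : expR (- b) = expR (- a) * expR (a - b)).
    by rewrite ler_wpM2l ?expR_ge0// expR_ge1Dx.
  by rewrite -expRD; congr expR; ring.
have e3 : expR (- b) <= 1 by rewrite expR_le1 oppr_le0.
have e4 := expR_ge0 (- a).
have e5 : 1 - a <= expR (- a) by exact: expR_ge1Dx.
rewrite ger0_norm; last by nra.
have [m1|m1] := leP 1 m; first by nra.
by nra.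
Qed.

(** With [A = <x, z>] and [B = <y, z>], the difference of the kernels is
    [exp(-A) - exp(-B) + (A - B)] minus [(x_j - y_j) z_j]. The first part gains the factor
    [min 1 (M (z_i + z_j))] over [|A - B|]: for [|z| <= 1] this turns [z_i] into at most
    [M (z_i^2 + z_j)], and for larger jumps the factor 1 suffices. A contribution [|x_j - y_j| z_j]
    comes from both parts, which uses the summand 2 of [2 * M + 2]. *)
Lemma Kfun_lip i (M : R) (x y z : R * R) : Rp2 x -> Rp2 y -> Rp2 z ->
  x.1 <= M -> x.2 <= M -> y.1 <= M -> y.2 <= M ->
  `|- Kfun i x z - - Kfun i y z| <= (2 * M + 2) * dist1 x y * mom i z.
Proof.
move=> x0 y0 z0 x1 x2 y1 y2.
rewrite -opprD normrN (dist1_crd _ _ i) /Kfun.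
have xi := crd_ge0 _ i x0; have xj := crd_ge0 _ (oth i) x0.
have yi := crd_ge0 _ i y0; have yj := crd_ge0 _ (oth i) y0.
have zi := crd_ge0 _ i z0; have zj := crd_ge0 _ (oth i) z0.
have xiM := crd_le _ i _ x1 x2; have xjM := crd_le _ (oth i) _ x1 x2.
have yiM := crd_le _ i _ y1 y2; have yjM := crd_le _ (oth i) _ y1 y2.
rewrite !(dotp_crd _ _ i) /mom.
have zn : enorm z <= 1 -> crd z i <= 1.
  rewrite (enorm_crd _ i) => zn; rewrite -(ger0_norm zi) -sqrtr_sqr.
  by apply: le_trans zn; rewrite ler_wsqrtr// lerDl sqr_ge0.
move: (crd x i) (crd x (oth i)) (crd y i) (crd y (oth i)) (crd z i) (crd z (oth i))
  xi xj yi yj zi zj xiM xjM yiM yjM zn => a a' b b' u u' a0 a'0 b0 b'0 u0 u'0 aM a'M bM b'M zn.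
set A := a * u + a' * u'; set B := b * u + b' * u'.
have A0 : 0 <= A by rewrite /A addr_ge0// mulr_ge0.
have B0 : 0 <= B by rewrite /B addr_ge0// mulr_ge0.
have Am : A <= M * (u + u') by rewrite /A; nra.
have Bm : B <= M * (u + u') by rewrite /B; nra.
have := expR_second_order A B _ A0 B0 Am Bm.
have -> : expR (- A) - 1 + a * u - (expR (- B) - 1 + b * u) =
   expR (- A) - expR (- B) + (A - B) - (a' - b') * u' by rewrite /A /B; ring.
move: (expR (- A) - expR (- B) + (A - B)) => e He.
have AB : `|A - B| <= `|a - b| * u + `|a' - b'| * u'.
  have -> : A - B = (a - b) * u + (a' - b') * u' by rewrite /A /B; ring.
  by apply: le_trans (ler_normD _ _) _; rewrite !normrM (ger0_norm u0) (ger0_norm u'0).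
have M0 : 0 <= M by exact: le_trans aM.
apply: le_trans (ler_normB _ _) _; rewrite normrM (ger0_norm u'0).
move: `|A - B| `|a - b| `|a' - b'| `|e| (normr_ge0 (a - b)) (normr_ge0 (a' - b')) (normr_ge0 (A - B)) AB He
  => h d d' n d0 d'0 h0 hd hn.
have mn1 : Num.min 1 (M * (u + u')) <= 1 by rewrite ge_min lexx.
have mnM : Num.min 1 (M * (u + u')) <= M * (u + u') by rewrite ge_min lexx orbT.
have mn0 : 0 <= Num.min 1 (M * (u + u')).
  by rewrite le_min ler01/= mulr_ge0// addr_ge0.
move: (Num.min _ _) mn1 mnM mn0 hn => c c1 cM c0 hn.
have du := mulr_ge0 d0 u0; have du' := mulr_ge0 d'0 u'0.
have hc : n <= d * (u * c) + d' * u'.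
  apply: (le_trans hn); apply: (@le_trans _ _ ((d * u + d' * u') * c)).
    exact: ler_wpM2r.
  by have := ler_wpM2l du' c1; rewrite mulr1 => ?; lra.
have d'u' := mulr_ge0 d0 u'0.
case: ifPn => [/zn u1|_].
- have uc : u * c <= M * (u ^+ 2 + u').
    apply: (@le_trans _ _ (u * (M * (u + u')))); first exact: ler_wpM2l.
    rewrite (_ : u * _ = M * (u ^+ 2 + u * u')); last by ring.
    by apply: ler_wpM2l => //; rewrite lerD2l; nra.
  have P0 : 0 <= u ^+ 2 + u' by rewrite addr_ge0// sqr_ge0.
  have uP : u' <= u ^+ 2 + u' by rewrite lerDr sqr_ge0.
  move: (u ^+ 2 + u') P0 uP uc => P P0 uP uc.
  have h1 := ler_wpM2l d0 uc.
  have h2 := ler_wpM2l d'0 uP.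
  have h3 : 0 <= M * (d * P) by rewrite !mulr_ge0.
  have h4 : 0 <= M * (d' * P) by rewrite !mulr_ge0.
  have h5 : 0 <= d * P by rewrite !mulr_ge0.
  rewrite (_ : (2 * M + 2) * (d + d') * P = 2 * (M * (d * P))
    + 2 * (M * (d' * P)) + 2 * (d * P) + 2 * (d' * P)); last by ring.
  move: h1; rewrite (_ : d * (M * P) = M * (d * P)); last by ring.
  by lra.
- have uc : u * c <= u by rewrite -[leRHS]mulr1; exact: ler_wpM2l.
  have h1 := ler_wpM2l d0 uc.
  have h3 : 0 <= M * ((d + d') * (u + u')) by rewrite !mulr_ge0// addr_ge0.
  have h4 := mulr_ge0 d'0 u0.
  rewrite (_ : (2 * M + 2) * (d + d') * (u + u') =
    2 * (M * ((d + d') * (u + u'))) + 2 * (d * u) + 2 * (d * u')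
    + 2 * (d' * u) + 2 * (d' * u')); last by ring.
  by lra.
Qed.

End ConcreteTerms.

(** * The equation of the theorem as a system of five terms *)

Section Params.
Context {R : realType}.
Implicit Types (r s t : R) (w : R -> R * R).

Definition time_term (m : {measure set R -> \bar R}) (f : R * R -> R) : term :=
  @Term R _ _ m idfun setT (fun x _ => f x) (fun=> 1).

Lemma time_term_ok (m : {measure set R -> \bar R}) (f : R * R -> R) t :
  (m (Ioc 0 t) < +oo)%E -> f (0, 0) = 0 ->
  (forall x, Rp2 x -> f x <= x.1 + x.2) ->
  (forall M x y, Rp2 x -> Rp2 y -> x.1 <= M -> x.2 <= M -> y.1 <= M -> y.2 <= M ->
    `|f x - f y| <= (2 * M + 2) * dist1 x y) ->
  term_ok t (time_term m f).
Proof.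
move=> mt f0 fu fl; split => //.
- exact: measurable_id.
- exact: measurableT.
- have E : tdom (time_term m f) (Ioc 0 t) = Ioc 0 t by exact: setIT.
  rewrite E.
  apply/integrableP; split; first by apply/measurable_EFinP; exact: measurable_cst.
  under eq_integral do rewrite /= normr1.
  by rewrite integral_cst ?mul1e//; exact: measurable_Ioc.
- by move=> x q x0 _; rewrite /= mulr1; exact: fu.
- by move=> M x y q *; rewrite /= mulr1; exact: fl.
Qed.

Lemma measurable_crd i : measurable_fun setT (fun z : R * R => crd z i).
Proof. by rewrite /crd; case: (i == ord0); [exact: measurable_fst|exact: measurable_snd]. Qed.

Lemma measurable_Rp2 : measurable (@Rp2 R).
Proof.
have -> : @Rp2 R = `[0%R, +oo[%classic `*` `[0%R, +oo[%classic.
  by apply/seteqP; split => -[a b]; rewrite /Rp2/= !in_itv/= !andbT.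
by apply: measurableX; exact: measurable_itv.
Qed.

Lemma measurable_Rp2_0 : measurable (@Rp2_0 R).
Proof.
apply: measurableD; first exact: measurable_Rp2.
have -> : [set (0, 0)] = [set (0 : R)] `*` [set (0 : R)].
  by apply/seteqP; split => -[a b] /=; [case=> -> ->|case=> /= -> ->].
by apply: measurableX; exact: measurable_set1.
Qed.

Lemma measurable_mom i : measurable_fun setT (@mom R i).
Proof.
apply: measurable_funD; last exact: measurable_crd.
apply: measurable_fun_if => //.
- apply: measurable_fun_ler => //.
  have ms : measurable_fun setT (@Num.sqrt R).
    by apply: continuous_measurable_fun; exact: sqrt_continuous.
  apply: (measurableT_comp ms); apply: measurable_funD; apply: measurable_funX.
  + exact: measurable_fst.
  + exact: measurable_snd.
- by apply: measurable_funX; apply: measurable_funTS; exact: measurable_crd.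
- by apply: measurable_funTS; exact: measurable_crd.
Qed.

Lemma measurable_mom_snd i : measurable_fun setT (fun q : R * (R * R) => mom i q.2).
Proof. by apply: (measurableT_comp (measurable_mom i)); exact: measurable_snd. Qed.

Definition kernel_term (m : {measure set (R * (R * R)) -> \bar R}) i : term :=
  @Term R _ _ m fst (setT `*` @Rp2_0 R)
    (fun x q => - Kfun i x q.2) (fun q => mom i q.2).

Lemma kernel_domE m i B : tdom (kernel_term m i) B = B `*` @Rp2_0 R.
Proof. by apply/seteqP; split => q; rewrite /tdom/=; tauto. Qed.

(** Signs are absorbed into the integrands, so that the equation reads forcing plus a sum. Indices 0
    and 1 are the Jordan parts of [b_ii(ds)], which enters with a minus sign: minus the positive
    part, plus the negative part. *)
Definition pterm (p : tcbve_params R) (i : 'I_2) (k : 'I_5) : term :=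
  match val k with
  | 0%N => time_term (mbp p i) (fun x => - crd x i)
  | 1%N => time_term (mbn p i) (fun x => crd x i)
  | 2%N => time_term (mbo p i) (fun x => crd x (oth i))
  | 3%N => time_term (mc p i) (fun x => - crd x i ^+ 2)
  | _ => kernel_term (mm p i) i
  end.

Lemma pterm_ok p t : params_ok p -> 0 <= t -> forall i k, term_ok t (pterm p i k).
Proof.
move=> pok t0 i k; have [[_ _ _ Sc] [_ _ _ [Jp Jn _ _]] [_ _ _ So] [_ _ mom_fin _]] := pok i.
have crd0 j : crd (0, 0) j = 0 :> R by rewrite /crd if_same.
have lin (M : R) (x y : R * R) j : Rp2 x -> Rp2 y -> x.1 <= M -> x.2 <= M -> y.1 <= M -> y.2 <= M ->
    `|crd x j - crd y j| <= (2 * M + 2) * dist1 x y.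
  move=> [x1 x2] _ xM _ _ _; apply: le_trans (crd_dist1 x y j) _.
  have M0 : 0 <= M by exact: le_trans xM.
  have d0 := dist1_ge0 x y; rewrite ler_peMl//; lra.
case: k => [[|[|[|[|k]]]] k5]; rewrite /pterm/=.
- apply: time_term_ok; first exact: Jp.
  + by rewrite crd0 oppr0.
  + by move=> x x0; have := crd_ge0 _ i x0; have [] := x0; lra.
  + by move=> M x y *; rewrite -opprD normrN; exact: lin.
- apply: time_term_ok; first exact: Jn.
  + by rewrite crd0.
  + by move=> x x0; exact: crd_sum_le.
  + by move=> M x y *; exact: lin.
- apply: time_term_ok; first by rewrite So// ltry.
  + by rewrite crd0.
  + by move=> x x0; exact: crd_sum_le.
  + by move=> M x y *; exact: lin.
- apply: time_term_ok; first by rewrite Sc// ltry.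
  + by rewrite crd0 expr0n oppr0.
  + move=> x x0; have [] := x0; have := sqr_ge0 (crd x i); lra.
  (* A difference of squares is the difference times the sum, and the sum is at most [2 * M]. *)
  + move=> M x y x0 y0 x1 x2 y1 y2; rewrite -opprD normrN subr_sqr normrM mulrC.
    have xi := crd_ge0 _ i x0; have yi := crd_ge0 _ i y0.
    apply: ler_pM => //; last exact: crd_dist1.
    rewrite ger0_norm ?addr_ge0//.
    by have := crd_le _ i _ x1 x2; have := crd_le _ i _ y1 y2; lra.
split => /=.
- exact: measurable_fst.
- by apply: measurableX => //; exact: measurable_Rp2_0.
- by move=> [s z] /= [_ [z0 _]]; exact: mom_ge0.
- rewrite kernel_domE; apply/integrableP; split.
    apply/measurable_EFinP; apply: measurable_funTS.
    exact: measurable_mom_snd.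
  apply: le_lt_trans (mom_fin t t0); apply: ge0_le_integral => //=.
  + by apply: measurableX; [exact: measurable_Ioc|exact: measurable_Rp2_0].
  + apply/measurable_EFinP; apply: measurable_funTS.
    by apply: measurableT_comp => //; exact: measurable_mom_snd.
  + apply/measurable_EFinP; apply: measurable_funTS.
    exact: measurable_mom_snd.
  + by move=> [s z] /= [_ [z0 _]]; rewrite lee_fin ger0_norm//; exact: mom_ge0.
- by move=> q; rewrite Kfun0 oppr0.
- by move=> x q x0 [_ [z0 _]]; exact: Kfun_lower.
- by move=> M x y q x0 y0 x1 x2 y1 y2 [_ [z0 _]]; exact: Kfun_lip.
Qed.

Lemma integrableN_iff d (T : measurableType d) (m : {measure set T -> \bar R}) D
    (f : T -> R) : measurable D ->
  m.-integrable D (EFin \o (fun x => - f x)) <-> m.-integrable D (fun x => (f x)%:E).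
Proof.
move=> mD; split => /(integrableN); apply: eq_integrable => // x _ /=.
by rewrite opprK.
Qed.

Lemma RintegralN d (T : measurableType d) (m : {measure set T -> \bar R}) D
    (f : T -> R) : measurable D -> m.-integrable D (fun x => (f x)%:E) ->
  \int[m]_(x in D) (- f x) = - \int[m]_(x in D) f x.
Proof.
move=> mD fi; rewrite -mulN1r -RintegralZl//.
by apply: eq_Rintegral => x _; rewrite mulN1r.
Qed.

(** The integrability clauses make each extended-real integral finite, so the equation descends to
    the reals as soon as the forcing is finite. *)
Lemma tcbve_eqP p t (a : 'I_2 -> R -> \bar R) (a' : 'I_2 -> R -> R) w :
  params_ok p -> 0 <= t -> (forall r i, 0 <= r <= t -> a i r = (a' i r)%:E) ->
  tcbve_eq p t a w <-> sol t (pterm p) a' w.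
Proof.
move=> pok t0 aE.
suff H r i : 0 <= r <= t ->
  ([/\ (mbp p i).-integrable (Ioc r t) (fun s => (crd (w s) i)%:E),
      (mbn p i).-integrable (Ioc r t) (fun s => (crd (w s) i)%:E),
      (mbo p i).-integrable (Ioc r t) (fun s => (crd (w s) (oth i))%:E),
      (mc p i).-integrable (Ioc r t) (fun s => (crd (w s) i ^+ 2)%:E) &
      (mm p i).-integrable (Ioc r t `*` @Rp2_0 R)
          (fun q => (Kfun i (w q.1) q.2)%:E)] /\
      ((crd (w r) i)%:E =
         a i r
         - (\int[mbp p i]_(s in Ioc r t) (crd (w s) i)%:E
            - \int[mbn p i]_(s in Ioc r t) (crd (w s) i)%:E)
         + \int[mbo p i]_(s in Ioc r t) (crd (w s) (oth i))%:E
         - \int[mc p i]_(s in Ioc r t) (crd (w s) i ^+ 2)%:E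
         - \int[mm p i]_(q in Ioc r t `*` @Rp2_0 R) (Kfun i (w q.1) q.2)%:E)%E) <->
  (forall k, tintegrable (pterm p i k) w r t) /\
  crd (w r) i = a' i r + \sum_(k < 5) tint (pterm p i k) w r t.
  split => W r rt i; first exact: (proj1 (H r i rt) (W r rt i)).
  exact: (proj2 (H r i rt) (W r rt i)).
move=> rt; rewrite aE//.
have mI := measurable_Ioc r t.
have mK : measurable (Ioc r t `*` @Rp2_0 R).
  by apply: measurableX => //; exact: measurable_Rp2_0.
have dT m f : tdom (time_term m f) (Ioc r t) = Ioc r t by exact: setIT.
have dK : tdom (kernel_term (mm p i) i) (Ioc r t) = Ioc r t `*` @Rp2_0 R.
  exact: kernel_domE.
have tintP : (forall k, tintegrable (pterm p i k) w r t) <->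
  [/\ (mbp p i).-integrable (Ioc r t) (fun s => (crd (w s) i)%:E),
      (mbn p i).-integrable (Ioc r t) (fun s => (crd (w s) i)%:E),
      (mbo p i).-integrable (Ioc r t) (fun s => (crd (w s) (oth i))%:E),
      (mc p i).-integrable (Ioc r t) (fun s => (crd (w s) i ^+ 2)%:E) &
      (mm p i).-integrable (Ioc r t `*` @Rp2_0 R)
          (fun q => (Kfun i (w q.1) q.2)%:E)].
  split.
    move=> H; split.
    - have := H (@Ordinal 5 0 isT); rewrite /tintegrable /pterm [val _]/= dT.
      by move/(integrableN_iff _ _ _ _ _ mI).
    - by have := H (@Ordinal 5 1 isT); rewrite /tintegrable /pterm [val _]/= dT.
    - by have := H (@Ordinal 5 2 isT); rewrite /tintegrable /pterm [val _]/= dT.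
    - have := H (@Ordinal 5 3 isT); rewrite /tintegrable /pterm [val _]/= dT.
      by move/(integrableN_iff _ _ _ _ _ mI).
    - have := H (@Ordinal 5 4 isT); rewrite /tintegrable /pterm [val _]/= dK.
      by move/(integrableN_iff _ _ _ _ _ mK).
  move=> [h1 h2 h3 h4 h5] [[|[|[|[|[|//]]]]] kj]; rewrite /tintegrable /pterm [val _]/= ?dT ?dK //.
  - exact/(integrableN_iff _ _ _ _ _ mI).
  - exact/(integrableN_iff _ _ _ _ _ mI).
  - exact/(integrableN_iff _ _ _ _ _ mK).
have fE d (T : measurableType d) (m : {measure set T -> \bar R}) D (f : T -> R) :
    measurable D -> m.-integrable D (fun x => (f x)%:E) ->
    (\int[m]_(x in D) (f x)%:E = (\int[m]_(x in D) f x)%:E)%E.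
  by move=> mD fi; rewrite /Rintegral fineK//; exact: integrable_fin_num.
have tT m f : tint (time_term m f) w r t = \int[m]_(s in Ioc r t) f (w s).
  by rewrite /tint dT.
have tK : tint (kernel_term (mm p i) i) w r t =
    \int[mm p i]_(q in Ioc r t `*` @Rp2_0 R) - Kfun i (w q.1) q.2.
  by rewrite /tint dK.
have sumE : \sum_(k < 5) tint (pterm p i k) w r t =
    tint (time_term (mbp p i) (fun x => - crd x i)) w r t
    + (tint (time_term (mbn p i) (fun x => crd x i)) w r t
    + (tint (time_term (mbo p i) (fun x => crd x (oth i))) w r t
    + (tint (time_term (mc p i) (fun x => - crd x i ^+ 2)) w r t
    + tint (kernel_term (mm p i) i) w r t))).
  by rewrite !big_ord_recl big_ord0 addr0.
rewrite {}sumE !tT tK tintP; split=> -[I E]; split=> //; have [h1 h2 h3 h4 h5] := I.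
- rewrite !RintegralN//; apply: EFin_inj; rewrite E !fE// -!EFinB.
  by congr EFin; ring.
- rewrite E !fE// -!EFinB !RintegralN//; congr EFin; ring.
Qed.
End Params.

(** * Discretization of the occupation measures *)

Section Grid.
Context {R : realType}.
Implicit Types (r s t : R) (f : R -> R) (n k : nat).

(* The grid is laid backwards from [t] with mesh [1 / (n + 1)], so that its last
   point is [t] itself; only grid points [>= 0] are used. *)
Definition grid_pt t n k : R := t - k%:R * n.+1%:R^-1.
Definition grid_idx t n s : nat := Num.truncn ((t - s) * n.+1%:R).
Definition grid_cell t n k : set R := [set s | 0 <= s <= t /\ grid_pt t n k.+1 < s <= grid_pt t n k].

Lemma grid_idxP t n s k : s <= t ->
  (grid_idx t n s == k) = (grid_pt t n k.+1 < s <= grid_pt t n k).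
Proof.
move=> st; have n0 : 0 < n.+1%:R :> R by rewrite ltr0n.
rewrite /grid_idx truncn_eq; last by rewrite mulr_ge0// subr_ge0.
rewrite /grid_pt andbC; congr (_ && _).
- by rewrite ltrBlDl -ltrBlDr ltr_pdivlMr.
- by rewrite lerBrDl -lerBrDr ler_pdivrMr.
Qed.

Lemma grid_cellP t n s k : 0 <= s <= t -> grid_cell t n k s <-> grid_idx t n s = k.
Proof.
move=> /[dup] st0 /andP[s0 st]; rewrite /grid_cell/=.
by split => [[_]|/eqP]; [rewrite -grid_idxP// => /eqP|rewrite grid_idxP].
Qed.

Lemma grid_pt_idx t n s : s <= t ->
  grid_pt t n (grid_idx t n s).+1 < s <= grid_pt t n (grid_idx t n s).
Proof. by move=> st; rewrite -grid_idxP. Qed.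

Lemma grid_ptS t n k : grid_pt t n k = grid_pt t n k.+1 + n.+1%:R^-1.
Proof. by rewrite /grid_pt -[in RHS](natr1 k) mulrDl mul1r opprD addrA subrK. Qed.

Lemma grid_pt0 t n : grid_pt t n 0 = t. Proof. by rewrite /grid_pt mul0r subr0. Qed.

Lemma grid_pt_le t n k k' : (k <= k')%N -> grid_pt t n k' <= grid_pt t n k.
Proof. by move=> kk'; rewrite lerD2l lerN2 ler_wpM2r// ler_nat. Qed.

Lemma grid_pt_le_t t n k : grid_pt t n k <= t.
Proof. by rewrite -[leRHS](grid_pt0 t n) grid_pt_le. Qed.

Lemma grid_idx_le t n r s : s <= r -> (grid_idx t n r <= grid_idx t n s)%N.
Proof. by move=> sr; apply: le_truncn; rewrite ler_wpM2r// lerD2l lerN2. Qed.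

Lemma measurable_grid_cell t n k : measurable (grid_cell t n k).
Proof.
have -> : grid_cell t n k = `[0, t]%classic `&` `]grid_pt t n k.+1, grid_pt t n k]%classic.
  by apply/seteqP; split => s; rewrite /grid_cell/= !in_itv.
by apply: measurableI; exact: measurable_itv.
Qed.

Lemma grid_pt_idx_cvg t s : s <= t -> grid_pt t n (grid_idx t n s) @[n --> \oo] --> s.
Proof.
move=> st; apply: (@squeeze_cvgr _ _ _ _ (cst s) (fun n => s + n.+1%:R^-1)).
- apply: nearW => n; have /andP[h1 ->] := grid_pt_idx t n s st.
  by rewrite [leLHS]grid_ptS lerD2r ltW.
- exact: cvg_cst.
- rewrite -[X in _ --> X]addr0; apply: cvgD; first exact: cvg_cst.
  exact: cvg_harmonic.
Qed.

(** The integral of [f] over [[r, t]] against the discretized measure. The cell containing [r]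
    counts in full, since its mass sits at its right end, which is [>= r]. *)
Definition grid_sum (z : {measure set R -> \bar R}) t n r f : R :=
  \sum_(k < (grid_idx t n r).+1) f (grid_pt t n k) * fine (z (grid_cell t n k)).

(** The sum is the integral over [[0, t]] of a step function [g n]: its value at [s] is that of [f]
    at the right end of the cell of [s], or 0 on cells below that of [r]. Grid points approach [s]
    from the right, so right-continuity gives pointwise convergence and [M] the domination. *)
Lemma grid_sum_cvg (z : {measure set R -> \bar R}) t r f M :
  (z (Icc 0 t) < +oo)%E -> 0 <= r <= t ->
  (forall s, r <= s <= t -> `|f s| <= M) ->
  (forall s, r <= s <= t -> f u @[u --> s^'+] --> f s) ->
  z.-integrable (Icc r t) (EFin \o f) /\
  grid_sum z t n r f @[n --> \oo] --> \int[z]_(s in Icc r t) f s.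
Proof.
move=> zt /[dup] rt0 /andP[r0 rt] fM fr.
have mD : measurable (Icc 0 t) by exact: measurable_itv.
have mrt : measurable (Icc r t) by exact: measurable_itv.
have M0 : 0 <= M by apply: le_trans (fM r _); rewrite ?normr_ge0// lexx.
pose g n s := \sum_(k < (grid_idx t n r).+1) f (grid_pt t n k) * \1_(grid_cell t n k) s.
have gE n s : 0 <= s <= t ->
    g n s = if (grid_idx t n s <= grid_idx t n r)%N then f (grid_pt t n (grid_idx t n s)) else 0.
  move=> st; rewrite /g; case: ifPn => [kk|kk].
    rewrite (bigD1 (Ordinal (kk : (_ < (grid_idx t n r).+1)%N)))//= big1 ?addr0.
      by rewrite indicE mem_set ?mulr1//; exact/grid_cellP.
    move=> k nk; rewrite indicE memNset ?mulr0// => /(grid_cellP _ _ _ _ st) e.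
    by move: nk; rewrite -val_eqE/= e eqxx.
  rewrite big1// => k _; rewrite indicE memNset ?mulr0// => /(grid_cellP _ _ _ _ st) e.
  by move: kk; rewrite e -ltnS ltn_ord.
have gM n s : 0 <= s <= t -> `|g n s| <= M.
  move=> st; rewrite gE//; case: ifPn => [kk|_]; last by rewrite normr0.
  apply: fM; rewrite grid_pt_le_t andbT.
  by have /andP[_ h] := grid_pt_idx t n r rt; apply: le_trans h _; exact: grid_pt_le.
have mg n : measurable_fun setT (g n).
  apply: measurable_sum => k; apply: measurable_funM => //.
  by apply: measurable_indic; exact: measurable_grid_cell.
have gcv s : 0 <= s <= t -> g n s @[n --> \oo] --> (f \_ (Icc r t)) s.
  move=> /[dup] st0 /andP[s0 st]; rewrite patchE; case: ifPn => srt.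
    move: srt => /set_mem; rewrite /Icc/= in_itv/= => /andP[rs _].
    rewrite (_ : (fun n => g n s) = (fun n => f (grid_pt t n (grid_idx t n s)))); last first.
      by apply/funext => n; rewrite gE// grid_idx_le.
    have fs := fr s; rewrite rs st in fs.
    move=> U nU; have := fs isT U nU.
    rewrite /= /at_right /within/= => H.
    change (\forall n \near \oo, U (f (grid_pt t n (grid_idx t n s)))).
    have Hn : \forall n \near \oo, s < grid_pt t n (grid_idx t n s) -> U (f (grid_pt t n (grid_idx t n s))).
      exact: (grid_pt_idx_cvg t s st _ H).
    apply: filterS Hn => n HU.
    (* The right limit ignores [s] itself; when the grid point equals [s], the neighbourhood [U] of
       [f s] contains [f s] anyway. *)
    have /andP[_ ] := grid_pt_idx t n s st; rewrite le_eqVlt => /orP[/eqP <-|//].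
    exact: nbhs_singleton.
  have sr : s < r.
    by move: srt; rewrite notin_setE /Icc/= in_itv/= st andbT => /negP; rewrite -ltNge.
  (* A point [s] below [r] may share the cell of [r] for some [n], but not once the mesh is below
     [r - s]. *)
  apply: cvg_near_cst; have sr0 : 0 < r - s by rewrite subr_gt0.
  apply: filterS (near_natSinv_lt _ _ sr0) => n nsr.
  rewrite gE//; case: ifPn => // kk.
  have /andP[h1 _] := grid_pt_idx t n s st; have /andP[_ h2] := grid_pt_idx t n r rt.
  have := grid_pt_le t n _ _ kk; move: h1 h2 nsr.
  rewrite (grid_ptS t n (grid_idx t n s)); move: (_^-1) => h; lra.
have zcell n k : z (grid_cell t n k) \is a fin_num.
  rewrite ge0_fin_numE//; apply: le_lt_trans zt; apply: le_measure.
  - by apply: mem_set; exact: measurable_grid_cell.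
  - exact: mem_set.
  - by move=> s [st _]; rewrite /Icc/= in_itv.
have icst (B : R) : z.-integrable (Icc 0 t) (EFin \o cst B).
  apply/integrableP; split; first by apply/measurable_EFinP; exact: measurable_cst.
  under eq_integral do rewrite /=.
  by rewrite integral_cst// lte_mul_pinfty// ?lee_fin ?normr_ge0.
have iM := icst M.
have i1 := icst 1.
have ig n : (\int[z]_(s in Icc 0 t) (g n s)%:E = (grid_sum z t n r f)%:E)%E.
  under eq_integral do rewrite -sumEFin.
  have ii k : z.-integrable (Icc 0 t) (fun s => (\1_(grid_cell t n k) s)%:E).
    apply: (le_integrable mD _ _ i1).
      apply/measurable_EFinP; apply: measurable_funTS.
      by apply: measurable_indic; exact: measurable_grid_cell.
    by move=> s _; rewrite /= lee_fin !ger0_norm// indicE.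
  rewrite integral_sum//; last first.
    move=> k; under eq_fun do rewrite EFinM; exact: integrableZl.
  rewrite -sumEFin; apply: eq_bigr => k _.
  under eq_integral do rewrite EFinM; rewrite integralZl//.
  rewrite integral_indic//; last exact: measurable_grid_cell.
  rewrite EFinM fineK//; congr (_ * z _)%E; apply: setIidl.
  by move=> s [st _]; rewrite /Icc/= in_itv.
have [] := @dominated_convergence _ _ _ z _ mD (fun n => EFin \o g n)
  (EFin \o (f \_ (Icc r t))) _ _ _ _ iM.
- by move=> n; apply/measurable_EFinP; exact: measurable_funTS.
- apply: (emeasurable_fun_cvg (fun n => EFin \o g n)) => //.
  + by move=> n; apply/measurable_EFinP; exact: measurable_funTS.
  + move=> s; rewrite /Icc/= in_itv/= => st; apply: cvg_EFin; [exact: nearW|exact: gcv].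
- by apply: aeW => s; rewrite /Icc/= in_itv/= => st; apply: cvg_EFin; [exact: nearW|exact: gcv].
- by apply: aeW => s n; rewrite /Icc/= in_itv/= => st; rewrite lee_fin; exact: gM.
move=> ifr _ cv.
have sub : Icc 0 t `&` Icc r t = Icc r t.
  apply: setIidr => s; rewrite /Icc/= !in_itv/= => /andP[rs ->].
  by rewrite (le_trans r0 rs).
have E : (EFin \o (f \_ (Icc r t))) = (EFin \o f) \_ (Icc r t).
  by apply/funext => s; rewrite /= !patchE; case: ifP.
have ifI : z.-integrable (Icc r t) (EFin \o f).
  rewrite -sub; apply/integrable_restrict => //.
  by rewrite -E.
split => //.
move: cv; rewrite E -integral_mkcondr sub => cv.
have -> : grid_sum z t ^~ r ^~ f = fine \o (fun n => \int[z]_(s in Icc 0 t) (g n s)%:E)%E.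
  by apply/funext => n /=; rewrite ig.
apply: fine_cvg; rewrite /Rintegral fineK//.
exact: integrable_fin_num.
Qed.

(** Compactness of [[0, t]], with the bound [M] as a parameter tending to infinity: the left limit,
    the value and the right limit bound [f] near each point. The guard [0 <= u] in the covering
    predicate discards the left side of 0, where no left limit is given. *)
Lemma cadlag_bounded f t : 0 <= t ->
  (forall s, 0 <= s -> f u @[u --> s^'+] --> f s) ->
  (forall s, 0 < s -> exists l : R, f u @[u --> s^'-] --> l) ->
  exists M, forall s, 0 <= s <= t -> `|f s| <= M.
Proof.
move=> t0 fr fl.
have := (@compact_near_coveringP R `[0, t]%classic).1 (@segment_compact R 0 t).
move=> /(_ R (pinfty_nbhs R) (fun M u => 0 <= u -> `|f u| <= M)) [].
  move=> x; rewrite /= in_itv/= => /andP[x0 xt].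
  have Hr : \forall u \near x^'+, `|f u| <= `|f x| + 1.
    by apply: (cvgr_norm_le _ (fr x x0)); rewrite ltrDl.
  have [B [B0 HB]] : exists B, 0 <= B /\ \forall u \near x, 0 <= u -> `|f u| <= B.
    have [x0' |x0'] := ltP 0 x.
      have [l fll] := fl x x0'; have Hl : \forall u \near x^'-, `|f u| <= `|l| + 1.
        by apply: (cvgr_norm_le _ fll); rewrite ltrDl.
      exists (`|f x| + 1 + (`|l| + 1)); split; first by rewrite !addr_ge0.
      move: Hl Hr; rewrite /at_left /at_right /within/= => Hl Hr.
      near=> u => u0.
      have hl : u < x -> `|f u| <= `|l| + 1 by near: u; exact: Hl.
      have hr : x < u -> `|f u| <= `|f x| + 1 by near: u; exact: Hr.
      have [ux|ux|->] := ltgtP u x.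
      - apply: (@le_trans _ _ (`|l| + 1)); last by rewrite lerDr addr_ge0.
        exact: hl.
      - apply: (@le_trans _ _ (`|f x| + 1)); last by rewrite lerDl addr_ge0.
        exact: hr.
      - by rewrite -addrA lerDl !addr_ge0.
    exists (`|f x| + 1); split; first by rewrite addr_ge0.
    move: Hr; rewrite /at_right /within/= => Hr.
    near=> u => u0.
    have hr : x < u -> `|f u| <= `|f x| + 1 by near: u; exact: Hr.
    have [ux|ux|->] := ltgtP u x.
    - by have := le_lt_trans u0 (lt_le_trans ux x0'); rewrite ltxx.
    - exact: hr.
    - by rewrite lerDl.
  exists (([set u | 0 <= u -> `|f u| <= B]), [set M | B < M]).
    by split => //=; exists B; split => //; exact: ger0_real.
  by move=> [u M] /= [Hu BM] u0; exact: le_trans (Hu u0) (ltW BM).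
move=> M [_ HM]; exists (M + 1) => s /andP[s0 st].
by apply: HM => //; [rewrite ltrDl|rewrite /= in_itv/= s0 st].
Unshelve. all: by end_near. Qed.

End Grid.

(** * The backward equation for the discretized measures *)

Section DiscreteSolution.
Context {R : realType}.
Context {p : tcbve_params R} {v : R -> R -> R * R -> R * R}
  {Q : R -> R -> R * R -> {measure set (R * R) -> \bar R}}
  (zeta : 'I_2 -> {measure set R -> \bar R}) (t : R).
Hypotheses (hp : params_ok p) (hv : v_ok p v) (hQ : Q_ok v Q) (t0 : 0 <= t).

Lemma ord2P (i : 'I_2) : i = ord0 \/ i = ord_max.
Proof. by case: i => [[|[|//]] i2]; [left|right]; exact: val_inj. Qed.

Lemma crdD (x y : R * R) i : crd (x + y) i = crd x i + crd y i.
Proof. by rewrite /crd; case: ifP. Qed.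

Lemma dotpDl (x y z : R * R) : dotp (x + y) z = dotp x z + dotp y z.
Proof. by rewrite /dotp/=; ring. Qed.

Lemma dotpC (x y : R * R) : dotp x y = dotp y x.
Proof. by rewrite /dotp; ring. Qed.

Lemma Rp2D (x y : R * R) : Rp2 x -> Rp2 y -> Rp2 (x + y).
Proof. by move=> [x1 x2] [y1 y2]; split; exact: addr_ge0. Qed.

Lemma dotp_ge0 (x y : R * R) : Rp2 x -> Rp2 y -> 0 <= dotp x y.
Proof. by move=> [x1 x2] [y1 y2]; rewrite addr_ge0// mulr_ge0. Qed.

Lemma measurable_expR_dotp (l : R * R) :
  measurable_fun setT (fun y : R * R => expR (- dotp l y)).
Proof.
apply: measurableT_comp => //; apply: measurableT_comp => //.
by apply: measurable_funD; exact: measurable_funM.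
Qed.

(** [exp(-<x, v>)] is the integral, against a probability carried by the quadrant, of a function
    that is at most 1 there. Hence [<x, v> >= 0] for all [x] in the quadrant, in particular for the
    unit vectors. *)
Lemma v_ge0 r s l : 0 <= r <= s -> Rp2 l -> Rp2 (v r s l).
Proof.
move=> rs l0; have [Q1 Q0 _ Qe] := hQ r s rs.
have key (x : R * R) : Rp2 x -> 0 <= dotp x (v r s l).
  move=> x0; rewrite -oppr_le0 -expR_le1 -lee_fin -Qe//.
  rewrite -(Q1 x x0) -[leRHS]mul1e -integral_cst//.
  apply: ae_ge0_le_integral => //=.
  - by apply/measurable_EFinP; exact: measurable_expR_dotp.
  exists (~` @Rp2 R); split; [|exact: Q0|].
  - by apply: measurableC; exact: measurable_Rp2.
  - move=> y /= ny y0; apply: ny => _.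
    by rewrite lee_fin expR_le1 oppr_le0 dotp_ge0.
split.
- have := key (1, 0); rewrite /dotp/= mul1r mul0r addr0; apply; split => //=.
- have := key (0, 1); rewrite /dotp/= mul1r mul0r add0r; apply; split => //=.
Qed.

Lemma v_sol s l : 0 <= s -> Rp2 l ->
  sol s (pterm p) (fun i _ => crd l i) (fun r => v r s l).
Proof.
move=> s0 l0; apply/(tcbve_eqP p s (fun i _ => (crd l i)%:E)) => //.
by have [_] := hv s l s0 l0.
Qed.

Definition cell_mass n k : R * R :=
  (fine (zeta ord0 (grid_cell t n k)), fine (zeta ord_max (grid_cell t n k))).

(* Transforming backwards the discretized functional: at each grid point the mass
   of the preceding cell is added and the cumulant semigroup [v] carries the sum
   to the next cell. *)
Fixpoint grid_lambda n k : R * R :=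
  if k is k'.+1 then cell_mass n k + v (grid_pt t n k) (grid_pt t n k') (grid_lambda n k')
  else cell_mass n 0.

Definition grid_w n r : R * R := v r (grid_pt t n (grid_idx t n r)) (grid_lambda n (grid_idx t n r)).

Definition grid_zeta n (i : 'I_2) r : R := grid_sum (zeta i) t n r (fun=> 1).

Lemma crd_cell_mass n k i : crd (cell_mass n k) i = fine (zeta i (grid_cell t n k)).
Proof. by have [->|->] := ord2P i. Qed.

Lemma cell_mass_ge0 n k : Rp2 (cell_mass n k).
Proof. by split; exact: fine_ge0. Qed.

Lemma grid_lambda_ge0 n k : 0 <= grid_pt t n k -> Rp2 (grid_lambda n k).
Proof.
elim: k => [|k ih] tk; first exact: cell_mass_ge0.
have kk : grid_pt t n k.+1 <= grid_pt t n k by exact: grid_pt_le.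
apply: Rp2D; first exact: cell_mass_ge0.
by apply: v_ge0; [rewrite tk|apply: ih; exact: le_trans kk].
Qed.

Lemma grid_w_ge0 n r : 0 <= r <= t -> Rp2 (grid_w n r).
Proof.
move=> /andP[r0 rt]; have /andP[_ h] := grid_pt_idx t n r rt.
by apply: v_ge0; [rewrite r0|apply: grid_lambda_ge0; exact: le_trans h].
Qed.

Lemma tint_eq k (w w' : R -> R * R) r s : measurable (tdom k (Ioc r s)) ->
  (forall x, r < x <= s -> w x = w' x) -> tintegrable k w r s ->
  tintegrable k w' r s /\ tint k w' r s = tint k w r s.
Proof.
move=> mD ww' iw.
have E : {in tdom k (Ioc r s), tfun k w =1 tfun k w'}.
  move=> q /set_mem[qrs _]; rewrite /tfun ww'//.
split; last by apply: eq_Rintegral => q qD; rewrite E.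
by apply: eq_integrable iw => // q qD /=; rewrite E.
Qed.

(** At a grid point, [grid_lambda] consists of the masses [S k i] collected so far and of the
    integrals from that point to [t]. [Good] states that what remains after subtracting the masses
    is exactly these integrals; it is propagated backwards cell by cell. *)
Lemma grid_w_sol n : sol t (pterm p) (grid_zeta n) (grid_w n).
Proof.
have tok := pterm_ok p t hp t0.
pose Good r i y := (forall j, tintegrable (pterm p i j) (grid_w n) r t) /\
  y = \sum_(j < 5) tint (pterm p i j) (grid_w n) r t.
pose S k i := \sum_(k' < k.+1) fine (zeta i (grid_cell t n k')).
have piece k r i : 0 <= r -> grid_pt t n k.+1 <= r <= grid_pt t n k ->
    Good (grid_pt t n k) i (crd (grid_lambda n k) i - S k i) ->
    Good r i (crd (v r (grid_pt t n k) (grid_lambda n k)) i - S k i).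
  move=> r0 /andP[kr rk] [ig E].
  have k0 : 0 <= grid_pt t n k by exact: le_trans rk.
  have [ivr Ev] := v_sol _ _ k0 (grid_lambda_ge0 n k k0) r (introT andP (conj r0 rk)) i.
  (* The left end [r] is excluded on purpose: at [r = grid_pt t n k.+1] the function [grid_w]
     already includes the next mass, whereas [v] does not. The integrals over [(r, grid_pt t n k]]
     do not see this jump. *)
  have wv x : r < x <= grid_pt t n k -> v x (grid_pt t n k) (grid_lambda n k) = grid_w n x.
    move=> /andP[rx xk]; have xt : x <= t by apply: le_trans xk _; exact: grid_pt_le_t.
    have /eqP e : grid_idx t n x == k by rewrite grid_idxP// xk (le_lt_trans kr rx).
    by rewrite /grid_w e.
  have H j : tintegrable (pterm p i j) (grid_w n) r t /\ tint (pterm p i j) (grid_w n) r t =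
      tint (pterm p i j) (fun x => v x (grid_pt t n k) (grid_lambda n k)) r (grid_pt t n k)
      + tint (pterm p i j) (grid_w n) (grid_pt t n k) t.
    have mD := tdom_measurable _ _ _ (tok i j) (measurable_Ioc r (grid_pt t n k)).
    have [i1 <-] := tint_eq _ _ _ _ _ mD wv (ivr j).
    by apply: (tint_split _ _ _ _ _ _ (tok i j)) => //; exact: grid_pt_le_t.
  split; first by move=> j; have [] := H j.
  rewrite Ev addrAC E -big_split/=; apply: eq_bigr => j _.
  by have [_ ->] := H j; rewrite addrC.
have good k i : 0 <= grid_pt t n k -> Good (grid_pt t n k) i (crd (grid_lambda n k) i - S k i).
  elim: k => [|k ih] k0.
    rewrite grid_pt0 /Good /S big_ord_recl big_ord0 addr0 /= crd_cell_mass subrr.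
    have e0 j : tdom (pterm p i j) (Ioc t t) = set0.
      rewrite /tdom (_ : Ioc t t = set0) ?preimage_set0 ?set0I//.
      by rewrite /Ioc set_itvoc0.
    split; first by move=> j; rewrite /tintegrable e0; exact: integrable_set0.
    by rewrite big1// => j _; rewrite /tint e0 Rintegral_set0.
  have kk : grid_pt t n k.+1 <= grid_pt t n k by exact: grid_pt_le.
  have := piece k (grid_pt t n k.+1) i k0; rewrite lexx kk => /(_ isT).
  have -> : crd (grid_lambda n k.+1) i - S k.+1 i =
      crd (v (grid_pt t n k.+1) (grid_pt t n k) (grid_lambda n k)) i - S k i.
    by rewrite /S big_ord_recr/= crdD crd_cell_mass; ring.
  by apply; apply: ih; exact: le_trans kk.
move=> r /andP[r0 rt] i; have /andP[h1 h2] := grid_pt_idx t n r rt.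
have [//||ig E] := piece (grid_idx t n r) r i r0.
- by rewrite h2 (ltW h1).
- by apply: good; exact: le_trans h2.
split => //; rewrite -E /grid_zeta /grid_sum.
under eq_bigr do rewrite mul1r.
by rewrite addrC subrK.
Qed.

End DiscreteSolution.
Arguments grid_lambda {R} v zeta t n k.
Arguments grid_w {R} v zeta t n r.

(** * Markov property *)

Lemma ge0_cvg_integral d (T : measurableType d) (R : realType)
    (m : {measure set T -> \bar R}) (D : set T) (u : (T -> \bar R)^nat)
    (f : T -> \bar R) : measurable D -> (forall n, measurable_fun D (u n)) ->
  (forall n x, D x -> 0 <= u n x)%E ->
  (forall x, D x -> {homo u ^~ x : n k / (n <= k)%N >-> (n <= k)%E}) ->
  (forall x, D x -> u n x @[n --> \oo] --> f x) ->
  (\int[m]_(x in D) u n x)%E @[n --> \oo] --> (\int[m]_(x in D) f x)%E.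
Proof.
move=> mD mu u0 nd uf.
have -> : (\int[m]_(x in D) f x = \int[m]_(x in D) limn (u ^~ x))%E.
  by apply: eq_integral => x /set_mem Dx; apply/esym/cvg_lim => //; exact: uf.
exact: cvg_monotone_convergence.
Qed.

Section Markov.
Context {R : realType}.
Context {v : R -> R -> R * R -> R * R}
  {Q : R -> R -> R * R -> {measure set (R * R) -> \bar R}} (hQ : Q_ok v Q)
  {d : measure_display} {Omega : measurableType d}
  {F : R -> R -> set (set Omega)} {X : R -> Omega -> R * R}
  {P : R -> R * R -> probability Omega R} (hX : is_TCBVE Q F X P).

Lemma F_measurable r s A : 0 <= r <= s -> F r s A -> measurable A.
Proof. by move=> rs FA; have [/(_ _ _ rs)[_ Fm] _ _ _ _] := hX; exact: Fm. Qed.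

Lemma F_setI r s A B : 0 <= r <= s -> F r s A -> F r s B -> F r s (A `&` B).
Proof.
move=> rs FA FB; have [/(_ _ _ rs)[sF _] _ _ _ _] := hX.
by have /(sigma_algebraP (fun A _ => @subsetT _ A))[_ _ _ +] := sF; apply.
Qed.

Lemma F_setT r s : 0 <= r <= s -> F r s setT.
Proof.
move=> rs; have [/(_ _ _ rs)[[F0 FC _] _] _ _ _ _] := hX.
by rewrite -(setD0 setT); exact: FC.
Qed.

Lemma F_mono r s u A : 0 <= r -> r <= s -> s <= u -> F r s A -> F r u A.
Proof. by move=> r0 rs su FA; have [_ /(_ _ _ _ r0 rs su)[H _] _ _ _] := hX; exact: H. Qed.

Lemma F_preimage r s B : 0 <= r -> r <= s -> measurable B -> F r s (X s @^-1` B).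
Proof. by move=> r0 rs mB; have [_ /(_ _ _ _ r0 rs (lexx s))[_ H] _ _ _] := hX; exact: H. Qed.

Lemma X_ge0 s om : 0 <= s -> Rp2 (X s om).
Proof. by move=> s0; have [_ _ /(_ om)[H _ _] _ _] := hX; exact: H. Qed.

Lemma X_measurable s : 0 <= s -> measurable_fun setT (X s).
Proof.
move=> s0 _ B mB; rewrite setTI; apply: (@F_measurable 0 s); first by rewrite lexx s0.
exact: F_preimage.
Qed.

Lemma Q_measurable s u B : 0 <= s <= u -> measurable B ->
  measurable_fun setT (fun om => Q s u (X s om) B).
Proof.
move=> /[dup] su /andP[s0 _] mB; have [_ _ mQ _] := hQ _ _ su.
apply: (measurable_comp measurable_Rp2 _ (mQ B mB) (X_measurable s s0)).
by move=> _ [om _ <-]; exact: X_ge0.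
Qed.

(** The definition gives the identity for indicators. Measurability of the kernel integral in [om]
    is carried along in the induction, since the additive and limit steps need it. *)
Lemma markov_fun r s u x A (f : R * R -> \bar R) :
  0 <= r -> r <= s -> s <= u -> Rp2 x -> F r s A ->
  measurable_fun setT f -> (forall y, 0 <= f y)%E ->
  (\int[P r x]_(om in A) f (X u om) =
   \int[P r x]_(om in A) \int[Q s u (X s om)]_y f y)%E.
Proof.
move=> r0 rs su x0 FA mf f0.
have s0 : 0 <= s by exact: le_trans rs.
have u0 : 0 <= u by exact: le_trans su.
have mA : measurable A by apply: F_measurable FA; rewrite r0.
have mX := X_measurable u u0.
have s0u : 0 <= s <= u by rewrite s0.
have mcomp (g : R * R -> \bar R) : measurable_fun setT g ->
    measurable_fun A (fun om => g (X u om)).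
  by move=> mg; apply: measurable_funTS; exact: measurableT_comp.
suff [] : measurable_fun setT (fun om => \int[Q s u (X s om)]_y f y)%E /\
  (\int[P r x]_(om in A) f (X u om) =
   \int[P r x]_(om in A) \int[Q s u (X s om)]_y f y)%E by [].
move: f mf f0; apply: ge0_measurable_ind.
- move=> B mB.
  have E om : (\int[Q s u (X s om)]_y (EFin \o \1_B) y)%E = Q s u (X s om) B.
    by rewrite integral_indic// setIT.
  rewrite (funext E); split; first exact: Q_measurable.
  have [_ _ _ _ /(_ r s u x r0 rs su x0 A B FA mB) M] := hX.
  rewrite -M -[RHS]mul1e.
  have -> : (fun om => (EFin \o \1_B) (X u om)) = (fun om => (\1_(X u @^-1` B) om)%:E : \bar R).
    by apply/funext => om; rewrite /= !indicE.
  rewrite mul1e integral_indic// 1?setIC//.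
  by rewrite -[X in measurable X]setTI; exact: mX.
- move=> k f k0 mf f0 [mI E].
  have Z om : (\int[Q s u (X s om)]_y (k%:E * f y))%E = (k%:E * \int[Q s u (X s om)]_y f y)%E.
    by rewrite ge0_integralZl_EFin.
  rewrite (funext Z); split; first exact: measurable_funeM.
  rewrite !ge0_integralZl_EFin ?E//.
  + by move=> om _; exact: integral_ge0.
  + exact: measurable_funTS.
  + exact: mcomp.
- move=> f g mf mg f0 g0 [mI E] [mI' E'].
  have Z om : (\int[Q s u (X s om)]_y (f y + g y))%E =
      (\int[Q s u (X s om)]_y f y + \int[Q s u (X s om)]_y g y)%E.
    by rewrite ge0_integralD.
  rewrite (funext Z); split; first exact: emeasurable_funD.
  have -> : (\int[P r x]_(om in A) (f (X u om) + g (X u om)) =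
      \int[P r x]_(om in A) f (X u om) + \int[P r x]_(om in A) g (X u om))%E.
    by rewrite ge0_integralD//; exact: mcomp.
  rewrite E E'; apply/esym/ge0_integralD => //.
  + by move=> om _; exact: integral_ge0.
  + exact: measurable_funTS.
  + by move=> om _; exact: integral_ge0.
  + exact: measurable_funTS.
- move=> h f mh h0 nd hf H.
  have cQ om : (\int[Q s u (X s om)]_y h n y)%E @[n --> \oo] -->
      (\int[Q s u (X s om)]_y f y)%E.
    by apply: ge0_cvg_integral.
  have mI n : measurable_fun setT (fun om => \int[Q s u (X s om)]_y h n y)%E.
    by have [] := H n.
  split.
    by apply: (emeasurable_fun_cvg (fun n om => \int[Q s u (X s om)]_y h n y)%E).
  have c1 : (\int[P r x]_(om in A) h n (X u om))%E @[n --> \oo] -->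
      (\int[P r x]_(om in A) f (X u om))%E.
    by apply: ge0_cvg_integral => // n; exact: mcomp.
  have c2 : (\int[P r x]_(om in A) \int[Q s u (X s om)]_y h n y)%E @[n --> \oo] -->
      (\int[P r x]_(om in A) \int[Q s u (X s om)]_y f y)%E.
    apply: ge0_cvg_integral => //.
    + by move=> n; exact: measurable_funTS.
    + by move=> n om _; exact: integral_ge0.
    + by move=> om _ n k nk; apply: ge0_le_integral => // y _; exact: nd.
  apply: cvg_unique c1 _; first exact: ereal_hausdorff.
  by move: c2; apply: cvg_trans; apply: near_eq_cvg; apply: nearW => n; have [] := H n.
Qed.

(** Conditional expectations are expressed by integrals over the sets [A] of [F r s]; the Laplace
    transform of [Q s u] evaluates the kernel integral. *)
Lemma markov_exp r s u x A l :
  0 <= r -> r <= s -> s <= u -> Rp2 x -> Rp2 l -> F r s A ->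
  (\int[P r x]_(om in A) (expR (- dotp l (X u om)))%:E =
   \int[P r x]_(om in A) (expR (- dotp (v s u l) (X s om)))%:E)%E.
Proof.
move=> r0 rs su x0 l0 FA.
have s0 : 0 <= s by exact: le_trans rs.
rewrite (markov_fun r s u x A (fun y => (expR (- dotp l y))%:E))//.
- have /hQ[_ _ _ He] : 0 <= s <= u by rewrite s0.
  by apply: eq_integral => om _; rewrite He// 1?dotpC//; exact: X_ge0.
- by apply/measurable_EFinP; exact: measurable_expR_dotp.
Qed.

(** Taking out what is known: two variables with the same conditional expectation given [F r s] keep
    this property after multiplication by a function of [X s]. For an indicator of [B], the factor
    just replaces [A] by its intersection with the event that [X s] lies in [B]. *)
Lemma weighted_integral_eq r s x (Y Y' : Omega -> R) :
  0 <= r -> r <= s ->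
  measurable_fun setT Y -> measurable_fun setT Y' ->
  (forall om, 0 <= Y om) -> (forall om, 0 <= Y' om) ->
  (forall A, F r s A -> \int[P r x]_(om in A) (Y om)%:E =
                        \int[P r x]_(om in A) (Y' om)%:E)%E ->
  forall h : R * R -> \bar R, measurable_fun setT h -> (forall y, 0 <= h y)%E ->
  forall A, F r s A ->
    (\int[P r x]_(om in A) (h (X s om) * (Y om)%:E) =
     \int[P r x]_(om in A) (h (X s om) * (Y' om)%:E))%E.
Proof.
move=> r0 rs mY mY' Y0 Y0' HY h mh h0 A FA.
have s0 : 0 <= s by exact: le_trans rs.
have rs0 : 0 <= r <= s by rewrite r0.
have mA : measurable A by exact: F_measurable FA.
have mX := X_measurable s s0.
have mZ (g : R * R -> \bar R) (Z : Omega -> R) : measurable_fun setT g ->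
    measurable_fun setT Z -> measurable_fun A (fun om => g (X s om) * (Z om)%:E)%E.
  move=> mg mZ; apply: measurable_funTS; apply: emeasurable_funM.
    exact: measurableT_comp.
  exact/measurable_EFinP.
move: h mh h0; apply: ge0_measurable_ind.
- move=> B mB.
  have E (Z : Omega -> R) : (\int[P r x]_(om in A) ((EFin \o \1_B) (X s om) * (Z om)%:E)
      = \int[P r x]_(om in A `&` X s @^-1` B) (Z om)%:E)%E.
    rewrite integral_mkcondr; apply: eq_integral => om _.
    rewrite patchE /= indicE; case: ifPn => [/set_mem/= XB|/negP XB].
      by rewrite mem_set// mul1e.
    by rewrite memNset ?mul0e// => XB'; apply: XB; exact: mem_set.
  rewrite !E; apply: HY; apply: F_setI => //; exact: F_preimage.
- move=> k f k0 mf f0 E.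
  under eq_integral do rewrite -muleA.
  under [RHS]eq_integral do rewrite -muleA.
  rewrite !ge0_integralZl_EFin ?E//.
  + by move=> om _; rewrite mule_ge0// lee_fin.
  + exact: mZ.
  + by move=> om _; rewrite mule_ge0// lee_fin.
  + exact: mZ.
- move=> f g mf mg f0 g0 E E'.
  have D (Z : Omega -> R) : (forall om, 0 <= Z om) -> measurable_fun setT Z ->
    (\int[P r x]_(om in A) ((f (X s om) + g (X s om)) * (Z om)%:E) =
     \int[P r x]_(om in A) (f (X s om) * (Z om)%:E) +
     \int[P r x]_(om in A) (g (X s om) * (Z om)%:E))%E.
    move=> Z0 mZ'; rewrite -ge0_integralD//.
    + by apply: eq_integral => om _; rewrite ge0_muleDl.
    + by move=> om _; rewrite mule_ge0// lee_fin.
    + exact: mZ.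
    + by move=> om _; rewrite mule_ge0// lee_fin.
    + exact: mZ.
  by rewrite !D// E E'.
- move=> h f mh h0 nd hf H.
  have c (Z : Omega -> R) : (forall om, 0 <= Z om) -> measurable_fun setT Z ->
    (\int[P r x]_(om in A) (h n (X s om) * (Z om)%:E))%E @[n --> \oo] -->
    (\int[P r x]_(om in A) (f (X s om) * (Z om)%:E))%E.
    move=> Z0 mZ'; apply: ge0_cvg_integral => //.
    + by move=> n; exact: mZ.
    + by move=> n om _; rewrite mule_ge0// lee_fin.
    + by move=> om _ n k nk; rewrite lee_wpmul2r// ?lee_fin//; exact: nd.
    + by move=> om _; apply: cvgeZr => //; exact: hf.
  apply: cvg_unique (c Y Y0 mY) _; first exact: ereal_hausdorff.
  rewrite (funext H); exact: c.
Qed.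

End Markov.

(** * Passage to the limit *)

Section Main.
Context {R : realType}.
Context {p : tcbve_params R} {v : R -> R -> R * R -> R * R}
  {Q : R -> R -> R * R -> {measure set (R * R) -> \bar R}}
  (hp : params_ok p) (hv : v_ok p v) (hQ : Q_ok v Q)
  {d : measure_display} {Omega : measurableType d}
  {F : R -> R -> set (set Omega)} (X : R -> Omega -> R * R)
  (P : R -> R * R -> probability Omega R) (hX : is_TCBVE Q F X P)
  (zeta : 'I_2 -> {measure set R -> \bar R}) (t : R) (t0 : 0 <= t)
  (zt : forall i, (zeta i (Icc 0 t) < +oo)%E).

Local Notation grid_lambda := (grid_lambda v zeta t).
Local Notation grid_w := (grid_w v zeta t).
Local Notation cell_mass := (cell_mass zeta t).
Local Notation grid_pt := (grid_pt t).
Local Notation grid_idx := (grid_idx t).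

Lemma grid_pt_ge n r : r <= t -> r <= grid_pt n (grid_idx n r).
Proof. by move=> rt; have /andP[] := grid_pt_idx t n r rt. Qed.

Lemma measurable_dotp_X (l : R * R) s : 0 <= s ->
  measurable_fun setT (fun om => dotp l (X s om)).
Proof.
move=> s0; have mX := X_measurable hX s s0.
apply: measurable_funD; apply: measurable_funM => //.
- by apply: (measurableT_comp measurable_fst).
- by apply: (measurableT_comp measurable_snd).
Qed.

Lemma measurable_expRN (Y : Omega -> R) : measurable_fun setT Y ->
  measurable_fun setT (fun om => expR (- Y om)).
Proof. by move=> mY; apply: measurableT_comp => //; exact: measurableT_comp. Qed.

(** Ranging over all [A] of [F r (grid_pt n m)] makes this an identity of conditional expectations.
    The induction, which moves backwards in time, needs that strength in order to insert the factor
    of the next grid point. *)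
Lemma markov_grid n m r x : 0 <= r -> r <= grid_pt n m -> Rp2 x ->
  forall A, F r (grid_pt n m) A ->
  (\int[P r x]_(om in A)
     (expR (- \sum_(k < m.+1) dotp (cell_mass n k) (X (grid_pt n k) om)))%:E =
   \int[P r x]_(om in A) (expR (- dotp (grid_lambda n m) (X (grid_pt n m) om)))%:E)%E.
Proof.
move=> r0 + x0; elim: m => [|m ih] rm A FA.
  by under eq_integral do rewrite big_ord_recl big_ord0 addr0.
have mm : grid_pt n m.+1 <= grid_pt n m by exact: grid_pt_le.
have rm' : r <= grid_pt n m by exact: le_trans mm.
have pos k : (k <= m.+1)%N -> 0 <= grid_pt n k.
  by move=> km; apply: le_trans (grid_pt_le t n _ _ km); exact: le_trans rm.
have l0 : Rp2 (grid_lambda n m) by apply: (grid_lambda_ge0 _ _ hQ); exact: pos.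
have key := weighted_integral_eq hX r (grid_pt n m.+1) x
  (fun om => expR (- \sum_(k < m.+1) dotp (cell_mass n k) (X (grid_pt n k) om)))
  (fun om => expR (- dotp (v (grid_pt n m.+1) (grid_pt n m) (grid_lambda n m)) (X (grid_pt n m.+1) om)))
  r0 rm.
transitivity (\int[P r x]_(om in A)
  ((expR (- dotp (cell_mass n m.+1) (X (grid_pt n m.+1) om)))%:E *
   (expR (- \sum_(k < m.+1) dotp (cell_mass n k) (X (grid_pt n k) om)))%:E))%E.
  by apply: eq_integral => om _; rewrite big_ord_recr/= opprD expRD EFinM muleC.
rewrite (key _ _ _ _ _ (fun y => (expR (- dotp (cell_mass n m.+1) y))%:E))//.
- by apply: eq_integral => om _; rewrite -EFinM -expRD -opprD -dotpDl.
- apply: measurable_expRN; apply: measurable_sum => k.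
  by apply: measurable_dotp_X; apply: pos; rewrite ltnW// ltnS ltn_ord.
- by apply: measurable_expRN; apply: measurable_dotp_X; exact: pos.
(* A set known at the earlier grid point is known at the later one, so the induction hypothesis
   applies to it before the Markov property moves back one cell. *)
- move=> B FB; rewrite ih//; last exact: (F_mono hX _ _ _ _ r0 rm mm FB).
  exact: (markov_exp hQ hX).
- by apply/measurable_EFinP; exact: measurable_expR_dotp.
Qed.

(** One more Markov step leads from the lowest grid point [>= r] down to [r]. There [X r = x] holds
    only almost surely, whence the comparison almost everywhere. *)
Lemma grid_w_laplace n r x : 0 <= r <= t -> Rp2 x ->
  (\int[P r x]_om
     (expR (- \sum_(k < (grid_idx n r).+1) dotp (cell_mass n k) (X (grid_pt n k) om)))%:E =
   (expR (- dotp x (grid_w n r)))%:E)%E.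
Proof.
move=> /andP[r0 rt] x0; have rg := grid_pt_ge n r rt.
rewrite markov_grid//; last by apply: (F_setT hX); rewrite r0.
have l0 : Rp2 (grid_lambda n (grid_idx n r)) by apply: (grid_lambda_ge0 _ _ hQ); exact: le_trans rg.
rewrite (markov_exp hQ hX r r)//; last first.
  by apply: (F_setT hX); rewrite r0 lexx.
have [_ _ _ PX _] := hX.
transitivity (\int[P r x]_om (expR (- dotp x (grid_w n r)))%:E)%E; last first.
  by rewrite integral_cst// [X in (_ * X)%E](_ : _ = 1%E) ?mule1//; exact: probability_setT.
have mx : measurable [set x].
  rewrite [x]surjective_pairing (_ : [set _] = [set x.1] `*` [set x.2]).
    by apply: measurableX; exact: measurable_set1.
  by apply/seteqP; split => -[a b] /=; [case=> -> ->|case=> /= -> ->].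
have mXx : measurable [set om | X r om = x].
  rewrite -[X in measurable X]setTI; exact: (X_measurable hX r r0 measurableT _ mx).
apply: ae_eq_integral => //.
- by apply/measurable_EFinP; apply: measurable_expRN; exact: measurable_dotp_X.
exists (~` [set om | X r om = x]); split.
- exact: measurableC.
- by apply: etrans (@probability_setC _ _ _ (P r x) _ mXx) _; rewrite PX// subee.
- by move=> om /= H e; apply: H => _; rewrite e dotpC.
Qed.

Definition occupation r om : R :=
  \sum_(i < 2) \int[zeta i]_(s in Icc r t) crd (X s om) i.

Definition laplace r x : R := \int[P r x]_om expR (- occupation r om).

Lemma crd_cvg (T : Type) (G : set_system T) (FG : Filter G) (f : T -> R * R) l i :
  f u @[u --> G] --> l -> crd (f u) i @[u --> G] --> crd l i.
Proof.
move=> fl; rewrite /crd; case: (i == ord0).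
- by apply: (cvg_comp _ _ fl); exact: cvg_fst.
- by apply: (cvg_comp _ _ fl); exact: cvg_snd.
Qed.

Lemma path_cvg r om i : 0 <= r <= t ->
  (zeta i).-integrable (Icc r t) (fun s => (crd (X s om) i)%:E) /\
  grid_sum (zeta i) t n r (fun s => crd (X s om) i) @[n --> \oo] -->
    \int[zeta i]_(s in Icc r t) crd (X s om) i.
Proof.
move=> /[dup] rt /andP[r0 _]; have [_ _ /(_ om)[_ XR XL] _ _] := hX.
have fr s : 0 <= s -> crd (X u om) i @[u --> s^'+] --> crd (X s om) i.
  by move=> s0; apply: crd_cvg; exact: XR.
have [M HM] : exists M, forall s, 0 <= s <= t -> `|crd (X s om) i| <= M.
  apply: cadlag_bounded => // s s0; have [l Xl] := XL s s0.
  by exists (crd l i); exact: crd_cvg.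
apply: (grid_sum_cvg _ _ _ _ M) => // s /andP[rs st].
  by apply: HM; rewrite st (le_trans r0 rs).
by apply: fr; exact: le_trans rs.
Qed.

Lemma sum_dotp_grid n r om :
  \sum_(k < (grid_idx n r).+1) dotp (cell_mass n k) (X (grid_pt n k) om) =
  \sum_(i < 2) grid_sum (zeta i) t n r (fun s => crd (X s om) i).
Proof.
rewrite exchange_big/=; apply: eq_bigr => k _.
rewrite !big_ord_recl big_ord0 addr0.
have -> : lift ord0 ord0 = oth ord0 :> 'I_2 by exact: val_inj.
rewrite (dotp_crd _ _ ord0) !crd_cell_mass.
by congr (_ + _); rewrite mulrC.
Qed.

Lemma occupation_cvg r om : 0 <= r <= t ->
  \sum_(k < (grid_idx n r).+1) dotp (cell_mass n k) (X (grid_pt n k) om) @[n --> \oo] -->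
  occupation r om.
Proof.
move=> rt; rewrite (funext (fun n => sum_dotp_grid n r om)).
by apply: cvg_bigsum => i; have [] := path_cvg r om i rt.
Qed.

Lemma expeR_occupation r om : 0 <= r <= t ->
  (expeR (- \sum_(i < 2) \int[zeta i]_(s in Icc r t) (crd (X s om) i)%:E) =
   (expR (- occupation r om))%:E)%E.
Proof.
move=> rt; rewrite /occupation -[RHS]/(expeR (- _)%:E) EFinN -sumEFin.
congr (expeR (- _)%E); apply: eq_bigr => i _.
rewrite /Rintegral fineK//; apply: integrable_fin_num; first exact: measurable_itv.
by have [] := path_cvg r om i rt.
Qed.

Lemma grid_pt_ge0 n r k : 0 <= r <= t -> (k < (grid_idx n r).+1)%N -> 0 <= grid_pt n k.
Proof.
move=> /andP[r0 rt] kr; apply: le_trans (grid_pt_le t n k (grid_idx n r) kr).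
exact: le_trans r0 (grid_pt_ge n r rt).
Qed.

(** The exponents are nonnegative sums, so 1 dominates. Measurability of [occupation] in [om] is
    obtained only here, as that of a limit of finite sums. *)
Lemma laplace_cvg r x : 0 <= r <= t -> Rp2 x ->
  [/\ (\int[P r x]_om (expR (- occupation r om))%:E = (laplace r x)%:E)%E,
      expR (- dotp x (grid_w n r)) @[n --> \oo] --> laplace r x &
      0 < laplace r x].
Proof.
move=> rt x0.
pose f n om : R := expR (- \sum_(k < (grid_idx n r).+1) dotp (cell_mass n k) (X (grid_pt n k) om)).
have mf n : measurable_fun setT (fun om => (f n om)%:E).
  apply/measurable_EFinP; apply: measurable_expRN; apply: measurable_sum => k.
  by apply: measurable_dotp_X; exact: (grid_pt_ge0 n r).
have cf om : (f n om)%:E @[n --> \oo] --> (expR (- occupation r om))%:E.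
  apply: cvg_EFin; first exact: nearW.
  apply: (cvg_comp _ expR); last exact: continuous_expR.
  by apply: cvgN; exact: occupation_cvg.
have mg : measurable_fun setT (fun om => (expR (- occupation r om))%:E).
  by apply: (emeasurable_fun_cvg (fun n om => (f n om)%:E)).
have i1 : (P r x).-integrable setT (EFin \o cst 1).
  apply/integrableP; split; first by apply/measurable_EFinP; exact: measurable_cst.
  under eq_integral do rewrite /= normr1.
  by rewrite integral_cst// mul1e [X in (X < _)%E](_ : _ = 1%E) ?ltry//; exact: probability_setT.
have f1 n om : `|f n om| <= 1.
  rewrite ger0_norm ?expR_ge0// expR_le1 oppr_le0; apply: sumr_ge0 => k _.
  apply: dotp_ge0; first exact: cell_mass_ge0.
  by apply: (X_ge0 hX); exact: (grid_pt_ge0 n r).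
have [] := @dominated_convergence _ _ _ (P r x) _ measurableT
  (fun n om => (f n om)%:E) (fun om => (expR (- occupation r om))%:E) _ mf mg _ i1.
- by apply: aeW => om _; exact: cf.
- by apply: aeW => om n _; rewrite lee_fin; exact: f1.
move=> ig _ cv.
have E : (\int[P r x]_om (expR (- occupation r om))%:E = (laplace r x)%:E)%E.
  by rewrite /laplace /Rintegral fineK//; exact: integrable_fin_num.
split => //.
  have -> : (fun n => expR (- dotp x (grid_w n r))) =
      fine \o (fun n => \int[P r x]_om (f n om)%:E)%E.
    by apply/funext => n /=; rewrite grid_w_laplace.
  by apply: fine_cvg; rewrite -E.
(* Strict positivity is what makes [ln] continuous at the limit. A vanishing integral would force a
   positive function to be 0 almost everywhere, so the whole space would be null under a
   probability. *)
have L0 : 0 <= laplace r x by apply: Rintegral_ge0 => om _; exact: expR_ge0.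
rewrite lt_neqAle L0 andbT eq_sym; apply/eqP => Le0.
have : (\int[P r x]_om `|(expR (- occupation r om))%:E| = 0)%E.
  by under eq_integral do rewrite gee0_abs ?lee_fin ?expR_ge0//; rewrite E Le0.
move=> /(ae_eq_integral_abs _ measurableT mg)[N [mN N0 sub]].
have NT : N = setT.
  apply/seteqP; split => // om _; apply: sub => /= /(_ I)/eqP.
  by rewrite eqe gt_eqF// expR_gt0.
have := @probability_setT _ _ _ (P r x); rewrite -NT.
by move: N0 => /= -> /eqP; rewrite eqe eq_sym oner_eq0.
Qed.

(** From a unit vector, the discretized functional is [exp] of minus one coordinate of [grid_w];
    [- ln] of its limit is the candidate for that coordinate. *)
Definition wlim r : R * R := (- ln (laplace r (1, 0)), - ln (laplace r (0, 1))).

Lemma dotp10 (y : R * R) : dotp (1, 0) y = y.1.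
Proof. by rewrite /dotp/= mul1r mul0r addr0. Qed.

Lemma dotp01 (y : R * R) : dotp (0, 1) y = y.2.
Proof. by rewrite /dotp/= mul1r mul0r add0r. Qed.

Lemma grid_w_cvg r : 0 <= r <= t ->
  (grid_w n r).1 @[n --> \oo] --> (wlim r).1 /\ (grid_w n r).2 @[n --> \oo] --> (wlim r).2.
Proof.
move=> rt.
have key (x : R * R) : Rp2 x -> dotp x (grid_w n r) @[n --> \oo] --> - ln (laplace r x).
  move=> x0; have [_ c L0] := laplace_cvg r x rt x0.
  rewrite (_ : (fun n => _) = (fun n => - ln (expR (- dotp x (grid_w n r))))); last first.
    by apply/funext => n; rewrite expRK opprK.
  have cl : ln u @[u --> laplace r x] --> ln (laplace r x) by exact: continuous_ln.
  by apply: cvgN; exact: (cvg_comp _ _ c cl).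
split.
- have R10 : Rp2 ((1, 0) : R * R) by split => /=.
  by have := key _ R10; under eq_fun do rewrite dotp10.
- have R01 : Rp2 ((0, 1) : R * R) by split => /=.
  by have := key _ R01; under eq_fun do rewrite dotp01.
Qed.

Lemma wlim_ge0 r : 0 <= r <= t -> Rp2 (wlim r).
Proof.
move=> rt; have [c1 c2] := grid_w_cvg r rt.
have pos n := grid_w_ge0 zeta t hQ n r rt.
split.
- by apply: (ler_cvg_to (cvg_cst 0) c1); apply: nearW => n; have [] := pos n.
- by apply: (ler_cvg_to (cvg_cst 0) c2); apply: nearW => n; have [] := pos n.
Qed.

(** Both sides are limits of [exp(-<x, grid_w n r>)], so linearity of the exponent in [x] survives
    the limit although [wlim] was defined from the unit vectors alone. *)
Lemma laplaceE r x : 0 <= r <= t -> Rp2 x ->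
  laplace r x = expR (- dotp x (wlim r)).
Proof.
move=> rt x0; have [_ c _] := laplace_cvg r x rt x0; have [c1 c2] := grid_w_cvg r rt.
apply: (cvg_unique _ c) => //.
apply: (cvg_comp _ expR); last exact: continuous_expR.
by apply: cvgN; apply: cvgD; exact: cvgMr.
Qed.

(** The cells are disjoint subsets of [[0, t]]; the resulting bound on the forcing does not depend
    on [n]. *)
Lemma grid_mass_le i n r : grid_sum (zeta i) t n r (fun=> 1) <= fine (zeta i (Icc 0 t)).
Proof.
rewrite /grid_sum; under eq_bigr do rewrite mul1r.
have sub k : grid_cell t n k `<=` Icc 0 t by move=> s [st _]; rewrite /Icc/= in_itv.
have mI : measurable (Icc 0 t) by exact: measurable_itv.
have fin k : zeta i (grid_cell t n k) \is a fin_num.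
  rewrite ge0_fin_numE//; apply: le_lt_trans (zt i); apply: le_measure => //.
  - by apply: mem_set; exact: measurable_grid_cell.
  - exact: mem_set.
rewrite -lee_fin fineK ?ge0_fin_numE// -sumEFin.
under eq_bigr do rewrite fineK//.
rewrite -(@measure_semi_additive_ord_I _ _ _ (zeta i) (grid_cell t n)).
- apply: le_measure; rewrite ?mem_set//.
  + by apply: bigsetU_measurable => k _; exact: measurable_grid_cell.
  + by rewrite -bigcup_mkord => s [k _]; exact: sub.
- by move=> k _; exact: measurable_grid_cell.
- move=> k k' _ _ [s [s1 s2]].
  have st : 0 <= s <= t by have [] := s1.
  by rewrite -(proj1 (grid_cellP _ _ _ _ st) s1) (proj1 (grid_cellP _ _ _ _ st) s2).
- by apply: bigsetU_measurable => k _; exact: measurable_grid_cell.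
Qed.

Definition zmass (i : 'I_2) r : R := fine (zeta i (Icc r t)).

Lemma zmass_fin i r : 0 <= r <= t -> zeta i (Icc r t) = (zmass i r)%:E.
Proof.
move=> /andP[r0 rt]; rewrite /zmass fineK// ge0_fin_numE//.
apply: le_lt_trans (zt i); apply: le_measure.
- by apply: mem_set; exact: measurable_itv.
- by apply: mem_set; exact: measurable_itv.
- by move=> s; rewrite /Icc/= !in_itv/= => /andP[rs ->]; rewrite (le_trans r0 rs).
Qed.

Let total : R := \sum_(i < 2) fine (zeta i (Icc 0 t)).

Lemma fine_zeta_le i : fine (zeta i (Icc 0 t)) <= total.
Proof. by rewrite /total (bigD1 i)//= lerDl; apply: sumr_ge0 => j _; exact: fine_ge0. Qed.

Lemma total_ge0 : 0 <= total.
Proof. by apply: sumr_ge0 => j _; exact: fine_ge0. Qed.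

Lemma zmass_le i r : 0 <= r <= t -> zmass i r <= total.
Proof.
move=> /[dup] rt /andP[r0 _]; apply: le_trans (fine_zeta_le i).
have tt : 0 <= (0 : R) <= t by rewrite lexx.
rewrite -lee_fin -zmass_fin// -[leRHS](zmass_fin i 0 tt); apply: le_measure.
- by apply: mem_set; exact: measurable_itv.
- by apply: mem_set; exact: measurable_itv.
- by move=> s; rewrite /Icc/= !in_itv/= => /andP[rs ->]; rewrite (le_trans r0 rs).
Qed.

Lemma wlim_sol : sol t (pterm p) zmass wlim.
Proof.
have tok := pterm_ok p t hp t0.
have [C [C0 HC]] := sol_apriori t (pterm p) t0 tok.
pose M := C * total.
have M0 : 0 <= M by rewrite mulr_ge0// total_ge0.
have nM n s : 0 <= s <= t -> [/\ Rp2 (grid_w n s), (grid_w n s).1 <= M & (grid_w n s).2 <= M].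
  move=> st; have [w1 w2] := grid_w_ge0 zeta t hQ n s st.
  have /(_ s st) : forall r, 0 <= r <= t -> (grid_w n r).1 + (grid_w n r).2 <= M.
    apply: (HC (grid_zeta zeta t n)) => //.
    + exact: total_ge0.
    + by move=> r i _; apply: le_trans (fine_zeta_le i); exact: grid_mass_le.
    + by move=> r rt; exact: (grid_w_ge0 _ _ hQ).
    + exact: (grid_w_sol _ _ hp hv hQ).
  by move=> H; split => //; lra.
have lM s : 0 <= s <= t -> [/\ Rp2 (wlim s), (wlim s).1 <= M & (wlim s).2 <= M].
  move=> st; have [c1 c2] := grid_w_cvg s st; split; first exact: wlim_ge0.
  - by apply: (ler_cvg_to c1 (cvg_cst M)); apply: nearW => n; have [] := nM n s st.
  - by apply: (ler_cvg_to c2 (cvg_cst M)); apply: nearW => n; have [] := nM n s st.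
move=> r /[dup] rt /andP[r0 rt'] i.
have sub x : r < x <= t -> 0 <= x <= t.
  by move=> /andP[rx ->]; rewrite (le_trans r0 (ltW rx)).
have ws n := grid_w_sol zeta t hp hv hQ t0 n r rt i.
have key k : tintegrable (pterm p i k) wlim r t /\
    tint (pterm p i k) (grid_w n) r t @[n --> \oo] --> tint (pterm p i k) wlim r t.
  apply: (tint_cvg _ _ _ _ _ _ M (tok i k)) => //.
  - by move=> n; have [H _] := ws n; exact: H.
  - by move=> n x /sub; exact: nM.
  - by move=> x /sub; exact: lM.
  - by move=> x /sub/grid_w_cvg[].
  - by move=> x /sub/grid_w_cvg[].
split; first by move=> k; have [] := key k.
have cl : crd (grid_w n r) i @[n --> \oo] --> crd (wlim r) i.
  by have [c1 c2] := grid_w_cvg r rt; have [->|->] := ord2P i.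
apply: (cvg_unique _ cl) => //.
rewrite (_ : (fun n => _) =
    (fun n => grid_zeta zeta t n i r + \sum_(k < 5) tint (pterm p i k) (grid_w n) r t)); last first.
  by apply/funext => n; have [_ ->] := ws n.
apply: cvgD; last by apply: cvg_bigsum => k; have [] := key k.
(* The discretized forcing is the grid sum of the constant 1, so it tends to the mass of the closed
   interval [[r, t]], a possible atom at [r] included. *)
have [||_] := grid_sum_cvg (zeta i) t r (fun=> 1) 1 (zt i) rt.
- by move=> s _; rewrite normr1.
- by move=> s _; exact: cvg_cst.
by rewrite Rintegral_cst ?mul1r//; exact: measurable_itv.
Qed.

End Main.

Theorem theorem1p2 (R : realType) (p : tcbve_params R) (hp : params_ok p)
  (v : R -> R -> R * R -> R * R) (hv : v_ok p v)
  (Q : R -> R -> R * R -> {measure set (R * R) -> \bar R}) (hQ : Q_ok v Q)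
  (d : measure_display) (Omega : measurableType d)
  (F : R -> R -> set (set Omega)) (X : R -> Omega -> R * R)
  (P : R -> R * R -> probability Omega R) (hX : is_TCBVE Q F X P)
  (zeta : 'I_2 -> {measure set R -> \bar R})
  (hzs : forall i, sigma_finite (Ici 0) (zeta i))
  (hzf : forall i (B : set R), measurable B -> B `<=` (Ici 0) ->
           (exists M : R, B `<=` Icc 0 M) -> (zeta i B < +oo)%E) :
  forall t : R, 0 <= t ->
  exists w : R -> R * R,
    [/\ forall r, 0 <= r <= t -> Rp2 (w r),
        tcbve_eq p t (fun i r => zeta i (Icc r t)) w,
        forall w' : R -> R * R,
          (forall r, 0 <= r <= t -> Rp2 (w' r)) ->
          tcbve_eq p t (fun i r => zeta i (Icc r t)) w' ->
          forall r, 0 <= r <= t -> w' r = w r &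
        forall r (x : R * R), 0 <= r <= t -> Rp2 x ->
          (\int[P r x]_om
             expeR (- \sum_(i < 2) \int[zeta i]_(s in Icc r t)
                                     (crd (X s om) i)%:E)
           = (expR (- dotp x (w r)))%:E)%E].
Proof.
move=> t t0.
have zt i : (zeta i (Icc 0 t) < +oo)%E.
  apply: hzf; first exact: measurable_itv.
  - by move=> s; rewrite /Icc /Ici/= !in_itv/= andbT => /andP[].
  - by exists t.
have tok := pterm_ok p t hp t0.
have eqP w : tcbve_eq p t (fun i r => zeta i (Icc r t)) w <-> sol t (pterm p) (zmass zeta t) w.
  by apply: tcbve_eqP => // r i; exact: zmass_fin.
have wl0 := wlim_ge0 hQ _ _ hX _ _ t0 zt.
have ws := wlim_sol hp hv hQ _ _ hX _ _ t0 zt.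
exists (wlim X P zeta t); split => //.
- exact/eqP.
- move=> w' w'0 /eqP sw' r rt.
  apply: (sol_unique t (pterm p) t0 tok (zmass zeta t) w' _ _) => // s i st.
  exact: zmass_le.
- move=> r x rt x0.
  under eq_integral do rewrite (expeR_occupation _ _ hX _ _ t0 zt)//.
  have [-> _ _] := laplace_cvg hQ _ _ hX _ _ t0 zt r x rt x0.
  by rewrite (laplaceE hQ _ _ hX _ _ t0 zt).
Qed.
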